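(* There are no data $(\sigma\colon\mathbb{F}_2^m\rightarrow\mathbb{F}_2^n,\ \varphi\colon A\twoheadrightarrow B)$ where $A$ is insolvable, i.e., such that one of the following holds: 1. $m\geq 3$ and $A\unrhd\operatorname{SL}_a(2^b)$ for some positive integers $a,b$ with $m=a\cdot b$ and $a>1$. 2. $m\geq 4$ and $A\unrhd\operatorname{Sp}_a(2^b)$ for some positive integers $a,b$ with $m=a\cdot b$ and $2\mid a$. 3. $m\geq 6$ and $A\unrhd G_2(2^b)'$ with $b=m/6$.
   Context: Matrix groups act on row vectors from the right, $x^g=xg$. Let $m,n$ be positive integers and $\sigma\colon\mathbb{F}_2^m\to\mathbb{F}_2^n$ a function. - $[\,,]_\sigma\colon\mathbb{F}_2^m\times\mathbb{F}_2^m\to\mathbb{F}_2^n$ is defined by $[x,y]_\sigma=\sigma(x+y)+\sigma(x)+\sigma(y)$. - An equivariance witness for $\sigma$ is a surjective group homomorphism $\varphi\colon A\twoheadrightarrow B$, where $A\leq\operatorname{GL}_m(2)$ acts transitively on $\mathbb{F}_2^m\setminus\{0\}$, $B\leq\operatorname{GL}_n(2)$ acts transitively on $\mathbb{F}_2^n\setminus\{0\}$, and $\sigma(x^g)=\sigma(x)^{\varphi(g)}$ for all $x\in\mathbb{F}_2^m$ and $g\in A$. - $\sigma$ is a squaring if it has an equivariance witness and $[\,,]_\sigma$ is biadditive and not constantly $0$. - A datum (plural: data) is a pair $(\sigma,\varphi)$ where $\sigma$ is a squaring and $\varphi$ is an equivariance witness for $\sigma$. For $m=ab$, $\operatorname{SL}_a(2^b)$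 and (for $a$ even) $\operatorname{Sp}_a(2^b)$ denote subgroups of $\operatorname{GL}_m(2)$ obtained by viewing $\mathbb{F}_2^m$ as $\mathbb{F}_{2^b}^a$ via some $\mathbb{F}_2$-linear identification (so each is determined up to conjugacy in $\operatorname{GL}_m(2)$, and the conditions refer to any such copy). Similarly, for $m=6b$ with $b$ a positive integer, $G_2(2^b)'$ denotes any copy of the derived subgroup of the Chevalley group $G_2(2^b)$ inside $\operatorname{Sp}_6(2^b)\leq\operatorname{GL}_6(2^b)\leq\operatorname{GL}_m(2)$ (unique up to conjugacy). $A\unrhd H$ means that $H$ is a normal subgroup of $A$. *)

(* Defs.v *)
From HB Require Import structures.
From mathcomp Require Import all_boot all_order all_algebra all_fingroup.
From mathcomp Require Import all_solvable all_field.

Set Implicit Arguments.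
Unset Strict Implicit.
Unset Printing Implicit Defensive.

Import GRing.Theory GroupScope.
Local Open Scope ring_scope.

(* {'GL_n[R]} consists of matrices of size n.-1.+1, so positive dimensions    *)
(* are written k.+1 throughout.                                               *)

Section NaturalAction.

Variables (F : finFieldType) (k : nat).

Definition rowact (x : 'rV[F]_k.+1) (g : {'GL_k.+1[F]}) : 'rV[F]_k.+1 :=
  x *m GLval g.

Fact rowact1 : rowact^~ 1%g =1 id.
Proof. by move=> x; rewrite /rowact GL_1E mulmx1. Qed.

Fact rowactM x : act_morph rowact x.
Proof. by move=> g h; rewrite /rowact GL_ME mulmxA. Qed.

Canonical rowaction := TotalAction rowact1 rowactM.

End NaturalAction.

Section Data.

Variables (m n : nat) (sigma : 'rV['F_2]_m.+1 -> 'rV['F_2]_n.+1).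

Definition sqbracket (x y : 'rV['F_2]_m.+1) : 'rV['F_2]_n.+1 :=
  sigma (x + y) + sigma x + sigma y.

Definition biadditive_bracket : Prop :=
  (forall x y z, sqbracket (x + y) z = sqbracket x z + sqbracket y z) /\
  (forall x y z, sqbracket x (y + z) = sqbracket x y + sqbracket x z).

Definition equivariance_witness (A : {group {'GL_m.+1(2)}})
    (B : {group {'GL_n.+1(2)}}) (phi : {morphism A >-> {'GL_n.+1(2)}}) : Prop :=
  [/\ [transitive A, on [set~ 0] | rowaction _ _],
      [transitive B, on [set~ 0] | rowaction _ _],
      phi @* A = B
    & forall x g, g \in A -> sigma (rowact x g) = rowact (sigma x) (phi g)].

Definition squaring : Prop :=
  [/\ exists (A : {group {'GL_m.+1(2)}}) (B : {group {'GL_n.+1(2)}})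
        (phi : {morphism A >-> {'GL_n.+1(2)}}), equivariance_witness B phi,
      biadditive_bracket
    & exists x y, sqbracket x y <> 0].

Definition datum (A : {group {'GL_m.+1(2)}}) (B : {group {'GL_n.+1(2)}})
    (phi : {morphism A >-> {'GL_n.+1(2)}}) : Prop :=
  squaring /\ equivariance_witness B phi.

End Data.

Section MatrixSets.

Variable F : finFieldType.

Definition SLmx (a : nat) : {set 'M[F]_a} := [set M | \det M == 1].

(* J is the Gram matrix of a nondegenerate alternating form. *)
Definition symplectic_gram (a : nat) (J : 'M[F]_a) : Prop :=
  J \in unitmx /\ forall u : 'rV[F]_a, u *m J *m u^T = 0.

Definition Spmx (a : nat) (J : 'M[F]_a) : {set 'M[F]_a} :=
  [set M | M *m J *m M^T == J].

(* The Chevalley group G_2(F), char F = 2, in its 6-dimensional module: the    *)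
(* 7-dimensional Weyl module with weights 0 and the six short roots, modulo    *)
(* its one-dimensional weight-0 radical. The i-th basis vector v_i has as      *)
(* weight the short root s_i at angle 60i degrees; indices are in Z/6, so      *)
(* s_(i+3) = - s_i and s_(i-1) + s_(i+1) = s_i, and the long roots are the     *)
(* s_i + s_(i+1). Acting on the right, exp(t e_r) for r = s_i does             *)
(*   v_(i+2) |-> v_(i+2) + t v_(i+1),   v_(i+4) |-> v_(i+4) + t v_(i+5),       *)
(*   v_(i+3) |-> v_(i+3) + t^2 v_i,                                            *)
(* and for r = s_i + s_(i+1) it does                                           *)
(*   v_(i+3) |-> v_(i+3) + t v_(i+1),   v_(i+4) |-> v_(i+4) + t v_i.           *)
(* The structure constants are +1 or -1, hence 1 in F.                         *)
Definition G2_short_root (i : 'I_6) (t : F) : 'M[F]_6 :=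
  1%:M + t *: (delta_mx (i + 2) (i + 1) + delta_mx (i + 4) (i + 5))
       + t ^+ 2 *: delta_mx (i + 3) i.

Definition G2_long_root (i : 'I_6) (t : F) : 'M[F]_6 :=
  1%:M + t *: (delta_mx (i + 3) (i + 1) + delta_mx (i + 4) i).

Definition G2 : {group {'GL_6[F]}} :=
  <<[set g : {'GL_6[F]} | [exists i : 'I_6, exists t : F,
       (GLval g == G2_short_root i t) || (GLval g == G2_long_root i t)]]>>%G.

Definition G2der_mx : {set 'M[F]_6} := @GLval 6 F @: (G2^`(1))%g.

(* The G_2-invariant alternating form pairs opposite short roots. *)
Definition G2_gram : 'M[F]_6 := \matrix_(i, j) (j == i + 3)%:R.

Let tr_addmx (X Y : 'M[F]_6) : (X + Y)^T = X^T + Y^T.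
Proof. exact: linearD. Qed.

Let tr_scalemx t (X : 'M[F]_6) : (t *: X)^T = t *: X^T.
Proof. exact: linearZ. Qed.

Lemma G2_gramT : G2_gram^T = G2_gram.
Proof.
by apply/matrixP=> i j; rewrite !mxE; congr (nat_of_bool _)%:R;
   case: i => -[|[|[|[|[|[|]]]]]] // ?; case: j => -[|[|[|[|[|[|]]]]]].
Qed.

Lemma mul_delta_gram (a b : 'I_6) :
  delta_mx a b *m G2_gram = delta_mx a (b + 3).
Proof.
apply/matrixP=> i j; rewrite !mxE (bigD1 b) //= big1 => [|k kb].
  by rewrite !mxE eqxx andbT addr0 -natrM mulnb.
by rewrite !mxE (negPf kb) andbF mul0r.
Qed.

Lemma G2_gram_symplectic : 2 \in [pchar F] -> symplectic_gram G2_gram.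
Proof.
move=> F2; have JJ : G2_gram *m G2_gram = 1%:M.
  rewrite -[X in X *m _]mul1mx [1%:M]matrix_sum_delta.
  rewrite !mulmx_suml; apply: eq_bigr => i _; rewrite !mulmx_suml.
  apply: eq_bigr => j _; rewrite -!scalemxAl !mul_delta_gram; congr (_ *: delta_mx _ _).
  by apply/val_inj; case: j => -[|[|[|[|[|[|]]]]]].
split=> [|u]; first by case/mulmx1_unit: JJ.
apply/matrixP=> i j; rewrite !ord1 !mxE.
have add33 (k : 'I_6) : k + 3 + 3 = k.
  by apply/val_inj; case: k => -[|[|[|[|[|[|]]]]]].
have uJ k : (u *m G2_gram) 0 k = u 0 (k + 3).
  rewrite mxE (bigD1 (k + 3)) //= big1 => [|l lk]; rewrite mxE.
    by rewrite add33 eqxx mulr1 addr0.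
  by case: (k =P l + 3) lk => [->|]; rewrite ?add33 ?eqxx ?mulr0.
pose w k : F := u 0 (inord k); have uw k : u 0 k = w (val k).
  by rewrite /w inord_val.
under eq_bigr do rewrite uJ mxE !uw.
rewrite !big_ord_recl big_ord0 addr0.
change (w 3 * w 0 + (w 4 * w 1 + (w 5 * w 2
  + (w 0 * w 3 + (w 1 * w 4 + w 2 * w 5)))) = 0 :> F).
rewrite (mulrC (w 0)) (mulrC (w 1)) (mulrC (w 2)) 2!addrA [X in _ + X]addrA.
exact: addrr_pchar2.
Qed.

Lemma gram_addX (X : 'M[F]_6) : 2 \in [pchar F] ->
    (X *m G2_gram)^T = X *m G2_gram -> X *m G2_gram *m X^T = 0 ->
  1%:M + X \in Spmx G2_gram.
Proof.
move=> F2 XJ XJX; rewrite inE linearD /= trmx1 mulmxDl mul1mx.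
rewrite mulmxDr mulmx1 mulmxDl XJX addr0 -addrA addrC -[X in _ == X]add0r.
apply/eqP; congr (_ + _); rewrite -{2}G2_gramT -trmx_mul XJ.
by apply/matrixP=> i j; rewrite [LHS]mxE addrr_pchar2 ?mxE.
Qed.

Lemma G2_short_root_Sp i t : 2 \in [pchar F] ->
  G2_short_root i t \in Spmx G2_gram.
Proof.
move=> F2; rewrite /G2_short_root -addrA; apply: gram_addX => //.
  rewrite mulmxDl -!scalemxAl mulmxDl !mul_delta_gram.
  rewrite linearD !linearZ linearD /= !trmx_delta -!addrA.
  rewrite [X in _ *: X + _]addrC; congr (_ *: (delta_mx _ _ + delta_mx _ _) + _);
  by apply/val_inj; case: i => -[|[|[|[|[|[|]]]]]].
set N := delta_mx _ _ + _; have NJ : N *m G2_gram =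
    delta_mx (i + 2) (i + 1 + 3) + delta_mx (i + 4) (i + 5 + 3).
  by rewrite mulmxDl !mul_delta_gram.
rewrite mulmxDl -!scalemxAl NJ mul_delta_gram {NJ}/N.
rewrite !(tr_addmx, tr_scalemx) !trmx_delta.
rewrite !(mulmxDl, mulmxDr, =^~ scalemxAl, =^~ scalemxAr).
rewrite !mul_delta_mx_0; try by case: i => -[|[|[|[|[|[|]]]]]].
by rewrite !(addr0, scaler0).
Qed.

Lemma G2_long_root_Sp i t : 2 \in [pchar F] ->
  G2_long_root i t \in Spmx G2_gram.
Proof.
move=> F2; apply: gram_addX => //.
  rewrite -!scalemxAl mulmxDl !mul_delta_gram.
  rewrite !linearZ linearD /= !trmx_delta.
  rewrite [X in _ *: X]addrC; congr (_ *: (delta_mx _ _ + delta_mx _ _));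
  by apply/val_inj; case: i => -[|[|[|[|[|[|]]]]]].
rewrite -!scalemxAl mulmxDl !mul_delta_gram.
rewrite !(tr_addmx, tr_scalemx) !trmx_delta.
rewrite !(mulmxDl, mulmxDr, =^~ scalemxAl, =^~ scalemxAr).
rewrite !mul_delta_mx_0; try by case: i => -[|[|[|[|[|[|]]]]]].
by rewrite !(addr0, scaler0).
Qed.

Lemma G2_sub_Sp (g : {'GL_6[F]}) : 2 \in [pchar F] -> g \in G2 ->
  GLval g \in Spmx G2_gram.
Proof.
move=> F2; have Sp_set : group_set [set h : {'GL_6[F]} | GLval h \in Spmx G2_gram].
  apply/group_setP; split=> [|x y]; rewrite !inE.
    by rewrite GL_1E mul1mx trmx1 mulmx1.
  move=> /eqP Jx /eqP Jy; rewrite GL_ME trmx_mul mulmxA -(mulmxA _ _ G2_gram).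
  by rewrite -(mulmxA _ _ (GLval y)^T) Jy Jx.
suff /subsetP sub : G2 \subset Group Sp_set by move=> /sub; rewrite inE.
rewrite gen_subG; apply/subsetP=> h; rewrite !inE => /existsP[i /existsP[t]].
by case/orP=> /eqP->; have := (G2_short_root_Sp i t F2, G2_long_root_Sp i t F2);
   rewrite !inE => -[].
Qed.

End MatrixSets.

(* The copy in GL_(m+1)(2) of a matrix group S over F, F_2^(m+1) being viewed  *)
(* as F^a through iota. Additive maps between F_2-spaces are F_2-linear.       *)
Definition scalar_restriction (F : finFieldType) (m a : nat)
    (iota : {additive 'rV['F_2]_m.+1 -> 'rV[F]_a}) (S : {set 'M[F]_a}) :
    {set {'GL_m.+1(2)}} :=
  [set g | [exists M in S, forall x, iota (rowact x g) == iota x *m M]].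

Definition normal_SL (m : nat) (A : {group {'GL_m.+1(2)}}) (a b : nat) : Prop :=
  exists (F : finFieldType) (iota : {additive 'rV['F_2]_m.+1 -> 'rV[F]_a}),
    [/\ #|F| = (2 ^ b)%N, bijective iota
      & scalar_restriction iota (SLmx F a) <| A].

Definition normal_Sp (m : nat) (A : {group {'GL_m.+1(2)}}) (a b : nat) : Prop :=
  exists (F : finFieldType) (iota : {additive 'rV['F_2]_m.+1 -> 'rV[F]_a})
      (J : 'M[F]_a),
    [/\ #|F| = (2 ^ b)%N, bijective iota, symplectic_gram J
      & scalar_restriction iota (Spmx J) <| A].

Definition normal_G2der (m : nat) (A : {group {'GL_m.+1(2)}}) (b : nat) : Prop :=
  exists (F : finFieldType) (iota : {additive 'rV['F_2]_m.+1 -> 'rV[F]_6}),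
    [/\ #|F| = (2 ^ b)%N, bijective iota
      & scalar_restriction iota (G2der_mx F) <| A].

(* Main.v *)
Require Import Defs.
From Stdlib Require Import Ring_theory Ring.
From HB Require Import structures.
From mathcomp Require Import all_boot all_order all_algebra all_fingroup.
From mathcomp Require Import all_solvable all_field.

Set Implicit Arguments.
Unset Strict Implicit.
Unset Printing Implicit Defensive.

Import GRing.Theory GroupScope.
Local Open Scope ring_scope.

(** Transitivity makes sigma surjective, without nontrivial zeros, and with
    fibres of equal size over the nonzero vectors; this size divides 2^m - 1,
    hence is odd.  So if g in A is an involution, every fixed vector of phi(g)
    is the image under sigma of a fixed vector of g.  In particular
    [x, x^g] = sigma(u) for some u fixed by g, since g swaps x and x^g.

    For suitable x and z this shows that the fibre of sigma over w = [x, z] is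
    stable under many transvections or root elements of the normal subgroup.
    If w were nonzero, sigma would be constant on the nonzero vectors of a
    3-dimensional F_2-subspace, which is impossible for a quadratic map.  Hence
    [ , ] vanishes.

    Two cases over F_2 need more.  For Sp_a(2), sigma is shown to be constant on
    the nonzero vectors of all hyperbolic planes.  For G_2(2)', the divisibility
    2^n - 1 | 63 gives n <= 3, where an element of order 8 forces the long root
    elements to act trivially on the codomain, or n = 6, where sigma is
    bijective and thus carries the fixed space of an element of order 3, a
    hyperbolic plane, onto a subspace. *)

(** * Finite fields with more than two, or at most two, elements *)

Lemma card_gt2_neq01 (F : finFieldType) :
  (2 < #|F|)%N -> exists2 k : F, k != 0 & k != 1.
Proof.
move=> q2; have /subsetPn[k _] : ~~ ([set: F] \subset [set 0; 1]).
  apply/negP=> /subset_leq_card; rewrite cardsT cards2 leqNgt.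
  by rewrite (leq_trans _ q2) // ltnS; case: eqP.
by rewrite !inE negb_or => /andP[]; exists k.
Qed.

Lemma card_F2_unit (F : finFieldType) (k : F) :
  (#|F| <= 2)%N -> k != 0 -> k = 1.
Proof.
move=> F_le2 k0; apply/eqP/negPn/negP=> k1.
have /subset_leq_card : [set 0; 1; k] \subset [set: F] by apply/subsetP=> ?.
rewrite cardsT setUC cardsU1 cards2 !inE (negPf k0) (negPf k1) eq_sym oner_neq0.
by rewrite leqNgt ltnS F_le2.
Qed.

(** * Equivariant quadratic maps *)

Definition bracket (U W : zmodType) (tau : U -> W) (x y : U) : W :=
  tau (x + y) + tau x + tau y.

(** What the arguments for the individual groups retain of a datum once [F_2^m] is identified with
    [F^a]. [equad_fix] reflects the odd size of the fibres, [equad_card] their equal size. *)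
Record equivariant_quadratic (F : finFieldType) (a n : nat)
    (S : {set 'M[F]_a}) (tau : 'rV[F]_a -> 'rV['F_2]_n) : Prop :=
  EquivariantQuadratic {
    equad_eq0 : forall v, tau v = 0 -> v = 0;
    equad_surj : forall w, exists v, tau v = w;
    equad_bracketDr : forall x y z,
      bracket tau x (y + z) = bracket tau x y + bracket tau x z;
    equad_lin : forall M, M \in S ->
      exists L : 'M['F_2]_n, forall v, tau (v *m M) = tau v *m L;
    equad_fix : forall M v, M \in S -> M *m M = 1%:M ->
      tau (v *m M) = tau v -> exists2 u, u *m M = u & tau u = tau v;
    equad_card : ((2 ^ n).-1 %| (#|F| ^ a).-1)%N
  }.

Lemma addvv_F2 m n (A : 'M['F_2]_(m, n)) : A + A = 0.
Proof. by apply/matrixP=> i j; rewrite !mxE addrr_pchar2 ?pchar_Fp. Qed.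

Lemma addvK_F2 m n (A B : 'M['F_2]_(m, n)) : A + (A + B) = B.
Proof. by rewrite addrA addvv_F2 add0r. Qed.

Lemma addv_eq0_F2 m n (A B : 'M['F_2]_(m, n)) : A + B = 0 -> A = B.
Proof. by move=> AB0; rewrite -[B](addvK_F2 A) AB0 addr0. Qed.

Lemma F2_cases (x : 'F_2) : x = 0 \/ x = 1.
Proof. by case: x => -[|[|]] // ?; [left | right]; apply: val_inj. Qed.

Ltac F2_module := apply/rowP=> ?; rewrite !mxE;
  repeat match goal with |- context [@fun_of_matrix _ _ _ ?A ?i ?j] =>
    case: (F2_cases (A i j)) => -> end; apply/eqP.

(** The two kinds of shears generate [SL_2(F)], which is transitive on nonzero pairs. *)
Lemma SL2_orbit (F : fieldType) (E : F -> F -> Prop) k0 l0 :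
    (forall k l s, E k l -> E (k + s * l) l) ->
    (forall k l s, E k l -> E k (l + s * k)) ->
    (k0 != 0) || (l0 != 0) -> E k0 l0 ->
  forall k l, (k != 0) || (l != 0) -> E k l.
Proof.
move=> Ek El kl0 E0.
have mvk k k' l : l != 0 -> E k l -> E k' l.
  by move=> l0' /(Ek _ _ ((k' - k) / l)); rewrite mulfVK // subrKC.
have mvl k l l' : k != 0 -> E k l -> E k l'.
  by move=> k0' /(El _ _ ((l' - l) / k)); rewrite mulfVK // subrKC.
have one0 := oner_neq0 F.
have E1 k l : l != 0 -> E k l.
  move=> ln0; apply: (mvk k0) => //.
  have [k00|k00] := eqVneq k0 0; last exact: mvl E0.
  move: kl0; rewrite k00 eqxx /= => l00.
  by apply: (mvk 1) => //; apply: (mvl _ l0) => //; apply: mvk E0.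
move=> k l; have [-> /=|ln0 _] := eqVneq l 0; last exact: E1.
by rewrite orbF => kn0; apply: (mvl _ 1) => //; apply: E1.
Qed.

Section Quadratic.

Variables (F : finFieldType) (a n : nat) (S : {set 'M[F]_a}).
Variable tau : 'rV[F]_a -> 'rV['F_2]_n.
Hypothesis tauP : equivariant_quadratic S tau.

Lemma bracketC x y : bracket tau x y = bracket tau y x.
Proof. by rewrite /bracket [x + y]addrC addrAC. Qed.

Lemma quadD x y : tau (x + y) = tau x + tau y + bracket tau x y.
Proof.
by rewrite /bracket; F2_module.
Qed.

Lemma bracketx0 x : bracket tau x 0 = 0.
Proof.
have := equad_bracketDr tauP x 0 0; rewrite addr0 => E.
by apply: (addrI (bracket tau x 0)); rewrite -E addr0.
Qed.

Lemma quad0 : tau 0 = 0.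
Proof. by have := bracketx0 0; rewrite /bracket addr0 addvv_F2 add0r. Qed.

(** Third differences of a quadratic map vanish, so its second difference does not depend on the
    base point [z]. *)
Lemma bracket_coset z x y :
  bracket tau x y = tau (z + (x + y)) + tau (z + x) + tau (z + y) + tau z.
Proof.
by rewrite !quadD (equad_bracketDr tauP); F2_module.
Qed.

(* The values of a quadratic map at the eight points of an affine 3-space     *)
(* over F_2 add up to zero.                                                   *)
Lemma quad_const_coset z p q r w :
    tau (z + p) = w -> tau (z + q) = w -> tau (z + r) = w ->
    tau (z + (p + q)) = w -> tau (z + (r + p)) = w -> tau (z + (r + q)) = w ->
    tau (z + (r + (p + q))) = w ->
  tau z = w.
Proof.
move=> tp tq tr tpq trp trq tpqr.
(* All three brackets take the value [b], so additivity reads [b = b + b]. *)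
have := equad_bracketDr tauP r p q; rewrite !(bracket_coset z).
rewrite tp tq tr tpq trp trq tpqr => E; pose b := w + w + w + tau z.
have -> : tau z = b + (b + b) + w by rewrite /b; F2_module.
by rewrite -[b + b]E -/b (addvv_F2 b) add0r.
Qed.

(** With [k] different from 0 and 1, every nontrivial [F_2]-combination of [x], [k *: x] and [y] has
    a nonzero coefficient at [x] or [y], so [quad_const_coset] applies to these three vectors. *)
Lemma quad_const_plane z x y w : (2 < #|F|)%N -> 2 \in [pchar F] ->
    (forall k l, (k != 0) || (l != 0) -> tau (z + (k *: x + l *: y)) = w) ->
  tau z = w.
Proof.
move=> q2 F2 E; have one0 := oner_neq0 F.
have [k k0 k1] := card_gt2_neq01 q2.
have {}k1 : 1 + k != 0 by rewrite addrC -[1](oppr_pchar2 F2) subr_eq0.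
have Ex h : h != 0 -> tau (z + h *: x) = w.
  by move=> h0; rewrite -(E h 0) ?h0 // scale0r addr0.
have Ey h : tau (z + (y + h *: x)) = w.
  by rewrite -(E h 1) ?one0 ?orbT // scale1r [y + _]addrC.
apply: (quad_const_coset (p := 1 *: x) (q := k *: x) (r := y));
  rewrite -?scalerDl ?Ex ?Ey //.
by have := Ey 0; rewrite scale0r addr0.
Qed.

Lemma quad_transport M x y : M \in S ->
  tau x = tau y -> tau (x *m M) = tau (y *m M).
Proof. by case/(equad_lin tauP)=> L tL txy; rewrite !tL txy. Qed.

Lemma bracket_transport M x y : M \in S ->
  bracket tau x y = 0 -> bracket tau (x *m M) (y *m M) = 0.
Proof.
case/(equad_lin tauP)=> L tL; rewrite /bracket -mulmxDl !tL -!mulmxDl => ->.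
by rewrite mul0mx.
Qed.

Lemma quad_stab M u v : M \in S -> u *m M = u -> tau v = tau u ->
  tau (v *m M) = tau v.
Proof. by move=> SM uM tvu; rewrite (quad_transport SM tvu) uM. Qed.

(* An involution swaps x and x *m M, hence fixes their bracket. *)
Lemma bracket_invol M (x : 'rV[F]_a) : M \in S -> M *m M = 1%:M ->
  exists2 u, u *m M = u & tau u = bracket tau x (x *m M).
Proof.
move=> SM MM; have [L tL] := equad_lin tauP SM.
(* By surjectivity [w = tau v]; if [L] fixes [w], then [v] and [v *m M] have the same value, as
   [equad_fix] requires. *)
have fixL w : w *m L = w -> exists2 u, u *m M = u & tau u = w.
  have [v <-] := equad_surj tauP w; rewrite -tL.
  exact: (equad_fix tauP).
apply: fixL; rewrite /bracket !mulmxDl -!tL mulmxDl -mulmxA MM mulmx1.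
by rewrite [x *m M + x]addrC -!addrA [tau x + _]addrC.
Qed.

(** The vector [u] of [bracket_invol] is fixed by [M'] too. A single involution thus makes the fibre
    stable under all elements of [S] that fix its fixed space pointwise. *)
Lemma bracket_stab_invol M M' (x v : 'rV[F]_a) :
    M \in S -> M' \in S -> M *m M = 1%:M ->
    (forall u : 'rV[F]_a, u *m M = u -> u *m M' = u) ->
    tau v = bracket tau x (x *m M) ->
  tau (v *m M') = tau v.
Proof.
move=> SM SM' MM sub tv; have [u uM tu] := bracket_invol x SM MM.
by apply: quad_stab (sub u uM) _ => //; rewrite tv tu.
Qed.

(** The linear map that [M] induces on values fixes [tau x], [tau y] and [tau (x + y)]. *)
Lemma bracket_stab M (x y v : 'rV[F]_a) : M \in S -> x *m M = x -> y *m M = y ->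
  tau v = bracket tau x y -> tau (v *m M) = tau v.
Proof.
case/(equad_lin tauP)=> L tL xM yM tv.
by rewrite tL tv /bracket !mulmxDl -!tL mulmxDl xM yM.
Qed.

(** Here [bracket_coset] reduces to [tau z = 0]. *)
Lemma quad_coset_eq0 x y z w : tau (z + x) = w -> tau (z + y) = w ->
  tau (z + (x + y)) = w -> bracket tau x y = w -> z = 0.
Proof.
move=> tzx tzy tzxy bxy; apply: (equad_eq0 tauP).
have := bracket_coset z x y; rewrite bxy tzx tzy tzxy addvv_F2 add0r => wz.
by apply: (addrI w); rewrite addr0 -wz.
Qed.

Lemma bracketxx x : 2 \in [pchar F] -> bracket tau x x = 0.
Proof.
move=> F2; rewrite /bracket.
have -> : x + x = 0 by apply/rowP=> i; rewrite !mxE addrr_pchar2.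
by rewrite quad0 add0r addvv_F2.
Qed.

Lemma bracket_eq0_delta :
    (forall i j k l,
       bracket tau (k *: delta_mx 0 i) (l *: delta_mx 0 j) = 0) ->
  forall x y, bracket tau x y = 0.
Proof.
have ext (f : 'rV[F]_a -> 'rV['F_2]_n) :
    (forall x y, f (x + y) = f x + f y) ->
    (forall l i, f (l *: delta_mx 0 i) = 0) -> forall x, f x = 0.
  move=> fD fd x; rewrite (row_sum_delta x).
  elim/big_rec: _ => [|i y _ yf]; last by rewrite fD fd yf addr0.
  by apply: (addrI (f 0)); rewrite -fD !addr0.
move=> bd x; apply: (ext) => [y z|l j]; first exact: (equad_bracketDr tauP).
rewrite bracketC; move: x; apply: (ext) => [y z|k i].
  exact: (equad_bracketDr tauP).
by rewrite bracketC bd.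
Qed.

End Quadratic.

(** * Special linear groups *)

Section Transvections.

Variables (F : finFieldType) (a : nat).
Implicit Types (v t : 'rV[F]_a) (f : 'cV[F]_a).

Definition pairing v f : F := (v *m f) 0 0.

Lemma pairingDl v t f : pairing (v + t) f = pairing v f + pairing t f.
Proof. by rewrite /pairing mulmxDl mxE. Qed.

Lemma pairingDr v f f' : pairing v (f + f') = pairing v f + pairing v f'.
Proof. by rewrite /pairing mulmxDr mxE. Qed.

Lemma pairingZl k v f : pairing (k *: v) f = k * pairing v f.
Proof. by rewrite /pairing -scalemxAl mxE. Qed.

Lemma pairingZr k v f : pairing v (k *: f) = k * pairing v f.
Proof. by rewrite /pairing -scalemxAr mxE. Qed.

Lemma pairing_delta v i : pairing v (delta_mx i 0) = v 0 i.
Proof. by rewrite /pairing -colE mxE. Qed.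

Definition transvection f t : 'M[F]_a := 1%:M + f *m t.

Lemma mul_transvection v f t : v *m transvection f t = v + pairing v f *: t.
Proof.
by rewrite mulmxDr mulmx1 mulmxA [v *m f]mx11_scalar mul_scalar_mx.
Qed.

Lemma fix_transvection v f t : t != 0 ->
  (v *m transvection f t == v) = (pairing v f == 0).
Proof.
move=> t0; rewrite mul_transvection -[X in _ == X]addr0 (inj_eq (addrI v)).
by rewrite scaler_eq0 (negPf t0) orbF.
Qed.

Hypothesis F2 : 2 \in [pchar F].

Lemma addvv_pchar2 v : v + v = 0.
Proof. by apply/rowP=> i; rewrite !mxE addrr_pchar2. Qed.

Lemma transvection_invol f t : pairing t f = 0 ->
  transvection f t *m transvection f t = 1%:M.
Proof.
move=> tf0; apply/row_matrixP=> i; rewrite !rowE mulmxA !mul_transvection.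
by rewrite pairingDl pairingZl tf0 mulr0 addr0 -addrA addvv_pchar2 addr0 mulmx1.
Qed.

(** The determinant [d] of an involution satisfies [(d - 1)^2 = d^2 - 1 = 0] in characteristic 2. *)
Lemma transvection_SL f t : pairing t f = 0 -> transvection f t \in SLmx F a.
Proof.
move=> /transvection_invol/(congr1 determinant); rewrite inE det_mulmx det1.
set d := \det _ => dd; rewrite -subr_eq0 -sqrf_eq0 oppr_pchar2 //.
by rewrite sqrrD mulr1 expr2 dd expr1n mulrn_pchar // addr0 addrr_pchar2.
Qed.

End Transvections.

Section SpecialLinear.

Variables (F : finFieldType) (a n : nat) (tau : 'rV[F]_a -> 'rV['F_2]_n).
Hypotheses (F2 : 2 \in [pchar F]) (tauP : equivariant_quadratic (SLmx F a) tau).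
Implicit Types (x z t v : 'rV[F]_a) (f : 'cV[F]_a).

(** [M] adds [z] to [x], and its fixed space is the kernel of [f]. [M'] fixes this kernel pointwise
    as well, and adds [t] to [v]. *)
Lemma SL_stab x z f t v : z != 0 ->
    pairing z f = 0 -> pairing x f != 0 -> pairing t f = 0 -> pairing v f != 0 ->
  tau v = bracket tau x z -> tau (v + t) = bracket tau x z.
Proof.
move=> z0 zf xf tf vf tv.
pose M := transvection ((pairing x f)^-1 *: f) z.
pose M' := transvection f ((pairing v f)^-1 *: t).
have zM : pairing z ((pairing x f)^-1 *: f) = 0 by rewrite pairingZr zf mulr0.
have xM : x *m M = x + z.
  by rewrite mul_transvection pairingZr mulVf // scale1r.
have -> : v + t = v *m M'.
  by rewrite mul_transvection scalerA mulfV // scale1r.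
rewrite -{1}tv; apply: (bracket_stab_invol tauP (M := M) (x := x)).
- exact: transvection_SL.
- by apply: transvection_SL => //; rewrite pairingZl tf mulr0.
- exact: transvection_invol.
- move=> u /eqP; rewrite fix_transvection // pairingZr mulf_eq0 invr_eq0.
  by rewrite (negPf xf) mul_transvection => /eqP->; rewrite scale0r addr0.
- by rewrite xM (equad_bracketDr tauP) (bracketxx tauP) // add0r.
Qed.

Lemma SL_plane x z f g u : x != 0 -> z != 0 ->
    pairing x f != 0 -> pairing z f = 0 -> pairing x g = 0 -> pairing z g != 0 ->
    pairing u f != 0 -> tau u = bracket tau x z ->
  forall k l, (k != 0) || (l != 0) -> tau (k *: x + l *: z) = bracket tau x z.
Proof.
move=> x0 z0 xf zf xg zg uf tu.
have mvx h v t : pairing z h = 0 -> pairing x h != 0 -> pairing t h = 0 ->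
    pairing v h != 0 -> tau v = bracket tau x z -> tau (v + t) = bracket tau x z.
  exact: SL_stab.
have mvz h v t : pairing x h = 0 -> pairing z h != 0 -> pairing t h = 0 ->
    pairing v h != 0 -> tau v = bracket tau x z -> tau (v + t) = bracket tau x z.
  by rewrite (bracketC tau x z); apply: SL_stab.
have dx k l : pairing (k *: x + l *: z) f = k * pairing x f.
  by rewrite pairingDl !pairingZl zf mulr0 addr0.
have dz k l : pairing (k *: x + l *: z) g = l * pairing z g.
  by rewrite pairingDl !pairingZl xg mulr0 add0r.
(* This multiple of [x] agrees with [u] modulo the kernel of [f], so one transvection carries [u]
   into the plane. *)
apply: (SL2_orbit (k0 := pairing u f / pairing x f) (l0 := 0)).
- move=> k l s E; have [l0|l0] := eqVneq l 0; first by rewrite l0 mulr0 addr0 -l0.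
  rewrite scalerDl addrAC; apply: (mvz g) => //.
    by rewrite pairingZl xg mulr0.
  by rewrite dz mulf_neq0.
- move=> k l s E; have [k0|k0] := eqVneq k 0; first by rewrite k0 mulr0 addr0 -k0.
  rewrite scalerDl addrA; apply: (mvx f) => //.
    by rewrite pairingZl zf mulr0.
  by rewrite dx mulf_neq0.
- by rewrite mulf_neq0 ?invr_eq0.
- rewrite -[_ + _](subrKC u); apply: (mvx f) => //.
  by rewrite -scaleN1r pairingDl dx pairingZl mulN1r mulfVK // subrr.
Qed.

(** A nonzero coordinate of a fibre element [u] determines the functional for [SL_plane]: at [i] it
    is [e i], at [j] the roles are exchanged, at a third index [k] it is [e i + e k]. *)
Lemma SL_plane_delta (i j : 'I_a) l m : i != j -> l != 0 -> m != 0 ->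
    let x := l *: delta_mx 0 i in let z := m *: delta_mx 0 j in
    bracket tau x z != 0 ->
  forall k k', (k != 0) || (k' != 0) -> tau (k *: x + k' *: z) = bracket tau x z.
Proof.
move=> ij l0 m0 x z b0.
have delta_neq0 h : (delta_mx 0 h : 'rV[F]_a) != 0.
  by apply/eqP=> /matrixP/(_ 0 h)/eqP; rewrite !mxE !eqxx oner_eq0.
have [x0 z0] : x != 0 /\ z != 0.
  by rewrite !scaler_eq0 !negb_or l0 m0 !delta_neq0.
pose e h : 'cV[F]_a := delta_mx h 0.
have xe h : pairing x (e h) = if h == i then l else 0.
  by rewrite pairingZl pairing_delta mxE eqxx /=; case: eqP; rewrite ?mulr1 ?mulr0.
have ze h : pairing z (e h) = if h == j then m else 0.
  by rewrite pairingZl pairing_delta mxE eqxx /=; case: eqP; rewrite ?mulr1 ?mulr0.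
have ji : (j == i) = false by rewrite eq_sym (negPf ij).
have [u tu] := equad_surj tauP (bracket tau x z).
have [k uk] : exists k, u 0 k != 0.
  apply/existsP; rewrite -negb_forall; apply: contra b0 => /forallP u0.
  rewrite -tu (_ : u = 0) ?(quad0 tauP) //.
  by apply/rowP=> h; rewrite mxE; apply/eqP.
have [ui|] := boolP (u 0 i != 0).
  by apply: (SL_plane (f := e i) (g := e j) (u := u));
    rewrite ?xe ?ze ?eqxx ?ji ?(negPf ij) ?pairing_delta.
rewrite negbK => /eqP ui.
have [uj|] := boolP (u 0 j != 0).
  move=> k1 k2 k12; rewrite addrC bracketC.
  by apply: (SL_plane (f := e j) (g := e i) (u := u));
    rewrite ?xe ?ze ?eqxx ?ji ?(negPf ij) ?pairing_delta 1?orbC // bracketC.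
rewrite negbK => /eqP uj.
have [ki kj] : (k == i) = false /\ (k == j) = false.
  by split; apply: contraNF uk => /eqP->; rewrite ?ui ?uj.
by apply: (SL_plane (f := e i + e k) (g := e j) (u := u));
  rewrite ?pairingDr ?xe ?ze ?eqxx ?ji ?ki ?kj ?(negPf ij) ?pairing_delta ?addr0
          ?ui ?add0r.
Qed.

Hypothesis big : (2 < #|F|)%N || (2 < a)%N.

Lemma SL_bracket_delta (i j : 'I_a) l m : i != j ->
  bracket tau (l *: delta_mx 0 i) (m *: delta_mx 0 j) = 0.
Proof.
move=> ij; have [->|l0] := eqVneq l 0.
  by rewrite scale0r bracketC (bracketx0 tauP).
have [->|m0] := eqVneq m 0; first by rewrite scale0r (bracketx0 tauP).
apply/eqP/negPn/negP=> b0; have := SL_plane_delta ij l0 m0 b0.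
move: (b0); set x := l *: _; set z := m *: _ => bn0 E.
have Ex k : k != 0 -> tau (k *: x) = bracket tau x z.
  by move=> k0; rewrite -(E k 0) ?k0 // scale0r addr0.
have Ez : tau z = bracket tau x z.
  by rewrite -(E 0 1) ?oner_neq0 ?orbT // scale0r scale1r add0r.
have Exz k : tau (z + k *: x) = bracket tau x z.
  by rewrite -(E k 1) ?oner_neq0 ?orbT // scale1r addrC.
case/negP: b0; apply/eqP.
have one0 := oner_neq0 F.
(* Over a larger field the plane of [x] and [z] contains a 3-space over [F_2]; otherwise a third
   unit vector [r] completes one. Either way [tau 0] equals the nonzero bracket. *)
case/orP: big => [q2|a2].
  rewrite -(quad0 tauP); apply/esym.
  apply: (quad_const_plane tauP (x := x) (y := z)) => // k k' kk'.
  by rewrite add0r E.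
have [h hi hj] : exists2 h : 'I_a, h != i & h != j.
  have /subsetPn[h _] : ~~ ([set: 'I_a] \subset [set i; j]).
    apply/negP=> /subset_leq_card; rewrite cardsT card_ord cards2 leqNgt.
    by rewrite (leq_trans _ a2) // ltnS; case: eqP.
  by rewrite !inE negb_or => /andP[]; exists h.
have [x0 z0] : x != 0 /\ z != 0.
  by split; apply: contra bn0 => /eqP->;
    rewrite ?(bracketx0 tauP) // bracketC (bracketx0 tauP).
pose e h' : 'cV[F]_a := delta_mx h' 0.
have xe h' : pairing x (e h') = if h' == i then l else 0.
  by rewrite pairingZl pairing_delta mxE eqxx /=; case: eqP; rewrite ?mulr1 ?mulr0.
have ze h' : pairing z (e h') = if h' == j then m else 0.
  by rewrite pairingZl pairing_delta mxE eqxx /=; case: eqP; rewrite ?mulr1 ?mulr0.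
pose r : 'rV[F]_a := delta_mx 0 h.
have re h' : pairing r (e h') = (h' == h)%:R by rewrite pairing_delta mxE eqxx.
have ji : (j == i) = false by rewrite eq_sym (negPf ij).
have Er v : pairing v (e i) != 0 -> tau v = bracket tau x z ->
    tau (r + v) = bracket tau x z.
  rewrite addrC => vi; apply: (SL_stab (f := e i)) => //.
  - by rewrite ze eq_sym ji.
  - by rewrite xe eqxx.
  - by rewrite re eq_sym (negPf hi).
have Erz : tau (r + z) = bracket tau x z.
  rewrite addrC (bracketC tau x); apply: (SL_stab (f := e j)) => //.
  - by rewrite xe ji.
  - by rewrite ze eqxx.
  - by rewrite re eq_sym (negPf hj).
  - by rewrite ze eqxx.
  - by rewrite bracketC.
have {}Ex : tau x = bracket tau x z by rewrite -[X in tau X]scale1r Ex.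
have {}Exz : tau (x + z) = bracket tau x z.
  by have := Exz 1; rewrite scale1r addrC.
rewrite -(quad0 tauP); apply/esym.
apply: (quad_const_coset tauP (p := x) (q := z) (r := r)); rewrite add0r //.
(* The vector [r] arises from [r + z] by adding [z]; the functional [e i + e h] kills [z] but not
   [r + z]. *)
- rewrite -[r]addr0 -(addvv_pchar2 F2 z) addrA.
  apply: (SL_stab (f := e i + e h)) => //;
    by rewrite ?pairingDl !pairingDr ?ze ?xe ?re ?eqxx ?(negPf ij) ?(negPf hj)
       ?(negPf hi) ?[i == h]eq_sym ?(negPf hi) ?addr0 ?add0r.
- by apply: Er => //; rewrite xe eqxx.
- apply: Er; first by rewrite pairingDl xe ze eqxx (negPf ij) addr0.
  exact: Exz.
Qed.

Lemma SL_bracket0 : (1 < a)%N -> forall x y, bracket tau x y = 0.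
Proof.
move=> a1; have bd (i j : 'I_a) l m :
    bracket tau (l *: delta_mx 0 i) (m *: delta_mx 0 j) = 0.
  have [<-|ij] := eqVneq i j; last exact: SL_bracket_delta.
  have [h hi] : exists h : 'I_a, h != i.
    have /subsetPn[h _] : ~~ ([set: 'I_a] \subset [set i]).
      by apply/negP=> /subset_leq_card; rewrite cardsT card_ord cards1 leqNgt a1.
    by rewrite inE; exists h.
  have ih : i != h by rewrite eq_sym.
  (* This transvection fixes the unit vector at [i] and adds it to the one at [h], which reduces
     equal indices to distinct ones. *)
  pose M := transvection (delta_mx h 0) (delta_mx 0 i : 'rV[F]_a).
  have SM : M \in SLmx F a.
    by apply: transvection_SL => //; rewrite pairing_delta mxE (negPf hi) andbF.
  have := bracket_transport tauP SM (SL_bracket_delta l m ih).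
  rewrite !mul_transvection !pairingZl !pairing_delta !mxE !eqxx (negPf hi) /=.
  rewrite mulr0 mulr1 scale0r addr0 (equad_bracketDr tauP).
  by rewrite SL_bracket_delta // add0r.
exact: (bracket_eq0_delta tauP).
Qed.

End SpecialLinear.

(** * Symplectic groups *)

Section Symplectic.

Variables (F : finFieldType) (a n : nat) (tau : 'rV[F]_a -> 'rV['F_2]_n).
Variable J : 'M[F]_a.
Hypotheses (F2 : 2 \in [pchar F]) (JP : symplectic_gram J).
Hypothesis tauP : equivariant_quadratic (Spmx J) tau.
Implicit Types (x y z c d p t u v : 'rV[F]_a).

Definition gram_form u v : F := pairing u (J *m v^T).
Local Notation B := gram_form.

Lemma gram_formDl u v z : B (u + v) z = B u z + B v z.
Proof. exact: pairingDl. Qed.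

Lemma gram_formDr u v z : B z (u + v) = B z u + B z v.
Proof. by rewrite /B linearD mulmxDr pairingDr. Qed.

Lemma gram_formZl k u v : B (k *: u) v = k * B u v.
Proof. exact: pairingZl. Qed.

Lemma gram_formxx u : B u u = 0.
Proof. by rewrite /B /pairing mulmxA (proj2 JP) mxE. Qed.

Lemma gram_formC u v : B u v = B v u.
Proof.
have := gram_formxx (u + v); rewrite gram_formDl !gram_formDr !gram_formxx.
by rewrite add0r addr0 => /eqP; rewrite addr_eq0 oppr_pchar2 // => /eqP.
Qed.

Lemma gram_formZr k u v : B u (k *: v) = k * B u v.
Proof. by rewrite gram_formC gram_formZl gram_formC. Qed.

Lemma gram_sym : J^T = J.
Proof.
apply/matrixP=> i j; have := gram_formC (delta_mx 0 j) (delta_mx 0 i).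
by rewrite /B /pairing !trmx_delta -!colE -!rowE !mxE.
Qed.

Lemma gram_form_nondeg x : x != 0 -> exists y, B x y != 0.
Proof.
move=> x0; have : x *m J != 0.
  by apply: contra x0 => /eqP xJ; rewrite -[x](mulmxK (proj1 JP)) xJ mul0mx.
move=> xJ0; have [i xJi] : exists i, (x *m J) 0 i != 0.
  apply/existsP; rewrite -negb_forall; apply: contra xJ0 => /forallP xJ0.
  by apply/eqP/rowP=> i; rewrite [RHS]mxE; apply/eqP.
exists (delta_mx 0 i).
by rewrite /B /pairing mulmxA trmx_delta -colE [col _ _ _ _]mxE.
Qed.

Lemma gram_form_neq0l x y : B x y != 0 -> x != 0.
Proof. by apply: contra => /eqP->; rewrite /B /pairing mul0mx mxE. Qed.

Lemma gram_form_neq0r x y : B x y != 0 -> y != 0.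
Proof. by rewrite gram_formC; apply: gram_form_neq0l. Qed.

Definition sp_transvection c k : 'M[F]_a := transvection (k *: (J *m c^T)) c.

Lemma mul_sp_transvection v c k :
  v *m sp_transvection c k = v + (k * B v c) *: c.
Proof. by rewrite mul_transvection pairingZr. Qed.

(** With [N = k *: (J *m c^T) *m c], the product [N *m J] is symmetric and [N *m J *m N^T = 0], so
    [J] changes only by twice [N *m J]. *)
Lemma sp_transvectionP c k : sp_transvection c k \in Spmx J.
Proof.
rewrite inE /sp_transvection /transvection.
set N := k *: _ *m c; have NT : (N *m J)^T = N *m J.
  rewrite /N -!scalemxAl linearZ /= !trmx_mul trmxK gram_sym.
  by rewrite !mulmxA.
have NJN : N *m J *m N^T = 0.
  have -> : N *m J *m N^T = N *m (N *m J)^T.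
    by rewrite (trmx_mul N J) gram_sym mulmxA.
  rewrite NT mulmxA (_ : N *m N = 0) ?mul0mx //.
  rewrite /N mulmxA -(mulmxA _ c) -scalemxAr mulmxA (proj2 JP).
  by rewrite scaler0 mulmx0 mul0mx.
rewrite linearD /= trmx1 mulmxDl mul1mx mulmxDr mulmx1 mulmxDl NJN addr0.
have -> : J *m N^T = N *m J by rewrite -[RHS]NT (trmx_mul N J) gram_sym.
rewrite -addrA.
rewrite (_ : N *m J + N *m J = 0) ?addr0 //.
by apply/matrixP=> i j; rewrite !mxE addrr_pchar2.
Qed.

Lemma sp_transvection_invol c k :
  sp_transvection c k *m sp_transvection c k = 1%:M.
Proof.
by apply: transvection_invol => //; rewrite pairingZr -/(B c c) gram_formxx mulr0.
Qed.

(** The transvection along [c] with scalar [(B x c)^-1] adds [c] to [x]. Its fixed space, the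
    hyperplane orthogonal to [c], is fixed pointwise by all transvections along [c]. *)
Lemma Sp_stab x c v k : B x c != 0 -> tau v = bracket tau x c ->
  tau (v + (k * B v c) *: c) = bracket tau x c.
Proof.
move=> xc tv; rewrite -{1}tv -mul_sp_transvection.
apply: (bracket_stab_invol tauP (M := sp_transvection c (B x c)^-1) (x := x)).
- exact: sp_transvectionP.
- exact: sp_transvectionP.
- exact: sp_transvection_invol.
- move=> u /eqP; rewrite fix_transvection ?(gram_form_neq0r xc) // pairingZr.
  rewrite mulf_eq0 invr_eq0 (negPf xc) /= => /eqP uc.
  by rewrite mul_sp_transvection /B uc mulr0 scale0r addr0.
- rewrite mul_sp_transvection mulVf // scale1r (equad_bracketDr tauP).
  by rewrite (bracketxx tauP) // add0r.
Qed.

Lemma Sp_stab_perp x c d v k : B x d = 0 -> B c d = 0 ->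
  tau v = bracket tau x c -> tau (v + (k * B v d) *: d) = bracket tau x c.
Proof.
move=> xd cd tv; rewrite -{1}tv -mul_sp_transvection.
apply: (bracket_stab tauP (x := x) (y := c)) => //.
- exact: sp_transvectionP.
- by rewrite mul_sp_transvection xd mulr0 scale0r addr0.
- by rewrite mul_sp_transvection cd mulr0 scale0r addr0.
Qed.

(** Transvections along [x] and [c] fix [p] and act on the plane of [x] and [c] as the shears of
    [SL2_orbit]. *)
Lemma hyperbolic_plane_orbit (E : 'rV[F]_a -> Prop) x c p k0 l0 :
    B x c != 0 -> B p x = 0 -> B p c = 0 ->
    (forall v k, E v -> E (v + (k * B v x) *: x)) ->
    (forall v k, E v -> E (v + (k * B v c) *: c)) ->
    (k0 != 0) || (l0 != 0) -> E (p + (k0 *: x + l0 *: c)) ->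
  forall k l, (k != 0) || (l != 0) -> E (p + (k *: x + l *: c)).
Proof.
move=> xc px pc Ex Ec; apply: SL2_orbit => k l s.
  move=> /(Ex _ (s / B c x)).
  rewrite !gram_formDl !gram_formZl px gram_formxx mulr0 !add0r mulrA.
  rewrite mulrAC mulfVK 1?gram_formC // -!addrA [l *: c + _]addrC.
  by rewrite [k *: x + _]addrA -scalerDl.
move=> /(Ec _ (s / B x c)).
rewrite !gram_formDl !gram_formZl pc gram_formxx mulr0 addr0 add0r mulrA.
by rewrite mulrAC mulfVK // -!addrA -scalerDl.
Qed.

(** Split a fibre element as [p] plus a vector of the plane of [x] and [c], with [p] orthogonal to
    that plane. If the plane part is nonzero, the orbit fills the coset and [quad_coset_eq0] gives
    [p = 0]. Otherwise [p] lies in the fibre, and transvections orthogonal to [x] and [c] fill a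
    plane through [p]. *)
Lemma Sp_const_plane x c : B x c != 0 -> bracket tau x c != 0 ->
  exists y d, B y d != 0 /\
    forall k l, (k != 0) || (l != 0) -> tau (k *: y + l *: d) = bracket tau x c.
Proof.
move=> xc b0; have one0 := oner_neq0 F.
pose E v := tau v = bracket tau x c.
have Ex v k : E v -> E (v + (k * B v x) *: x).
  by rewrite /E (bracketC tau x); apply: Sp_stab; rewrite gram_formC.
have Ec v k : E v -> E (v + (k * B v c) *: c) by apply: Sp_stab.
pose proj v := v + ((B v c / B x c) *: x + (B v x / B x c) *: c).
have projx v : B (proj v) x = 0.
  rewrite !gram_formDl !gram_formZl gram_formxx mulr0 add0r (gram_formC c).
  by rewrite mulfVK // addrr_pchar2.
have projc v : B (proj v) c = 0.
  rewrite !gram_formDl !gram_formZl gram_formxx mulr0 addr0.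
  by rewrite mulfVK // addrr_pchar2.
have projK v : v = proj v + ((B v c / B x c) *: x + (B v x / B x c) *: c).
  by rewrite /proj -addrA addvv_pchar2 // addr0.
have [u tu] := equad_surj tauP (bracket tau x c).
set p := proj u; set k0 := B u c / B x c; set l0 := B u x / B x c.
have Eu : E (p + (k0 *: x + l0 *: c)) by rewrite -projK.
have [kl0|] := boolP ((k0 != 0) || (l0 != 0)).
  have Epl := hyperbolic_plane_orbit xc (projx u) (projc u) Ex Ec kl0 Eu.
  have p0 : p = 0.
    apply: (quad_coset_eq0 tauP (x := x) (y := c) (w := bracket tau x c)) => //.
    - by have := Epl 1 0; rewrite one0 scale0r scale1r addr0; apply.
    - by have := Epl 0 1; rewrite one0 orbT scale0r scale1r add0r; apply.
    - by have := Epl 1 1; rewrite one0 !scale1r; apply.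
  exists x, c; split=> // k l kl; have := Epl k l kl.
  by rewrite -/p p0 add0r.
rewrite negb_or !negbK => /andP[/eqP k00 /eqP l00].
have {}Eu : E p by move: Eu; rewrite k00 l00 !scale0r !addr0.
have p0 : p != 0.
  by apply: contra b0 => /eqP p0; rewrite -Eu p0 (quad0 tauP).
have [y py] := gram_form_nondeg p0; pose d := proj y.
have pd : B p d != 0.
  by rewrite !gram_formDr !gram_formZr projx projc !mulr0 !addr0.
exists p, d; split=> // k l kl; rewrite -[X in tau X]add0r.
have B0 v : B 0 v = 0 by rewrite -(scale0r 0) gram_formZl mul0r.
apply: (hyperbolic_plane_orbit (E := E) pd (B0 _) (B0 _) _ _ (k0 := 1) (l0 := 0)).
- move=> v h; apply: Sp_stab_perp; rewrite gram_formC; [exact: projx|exact: projc].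
- move=> v h; apply: Sp_stab_perp; rewrite gram_formC; [exact: projx|exact: projc].
- by rewrite one0.
- by rewrite scale1r scale0r addr0 add0r.
- by [].
Qed.

(* Over the field of two elements a hyperbolic plane has only three nonzero   *)
(* vectors; the property that tau is constant on them spreads along           *)
(* transvections to all hyperbolic planes.                                    *)
Lemma Sp2_const x c : (#|F| <= 2)%N -> B x c != 0 ->
    tau x = tau c -> tau (x + c) = tau c ->
  forall v, v != 0 -> tau v = tau x.
Proof.
move=> F_le2; have B1 u v : B u v != 0 -> B u v = 1.
  exact: card_F2_unit.
pose R u v := [/\ B u v != 0, tau u = tau v & tau (u + v) = tau v].
(* The transvection along [v + y] fixes [u] and sends [v] to [y]. *)
have step u v y : R u v -> B u y != 0 -> B v y != 0 -> R u y.
  move=> [uv tuv tuvv] uy vy.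
  have uM : B u (v + y) = 0.
    by rewrite gram_formDr (B1 _ _ uv) (B1 _ _ uy) addrr_pchar2.
  have vM : B v (v + y) = 1.
    by rewrite gram_formDr gram_formxx add0r (B1 _ _ vy).
  split=> //.
    have /(_ _ _ tuv) := quad_transport tauP (sp_transvectionP (v + y) 1).
    rewrite !mul_sp_transvection uM vM mulr0 scale0r addr0.
    by rewrite mulr1 scale1r addrA addvv_pchar2 // add0r.
  have /(_ _ _ tuvv) := quad_transport tauP (sp_transvectionP (v + y) 1).
  rewrite !mulmxDl !mul_sp_transvection uM vM mulr0 scale0r addr0.
  by rewrite mulr1 scale1r [v + (v + y)]addrA addvv_pchar2 // add0r.
have spread u v y : R u v -> B u y != 0 -> R u y.
  move=> Ruv uy; have [vy|] := boolP (B v y != 0); first exact: step Ruv _ _.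
  rewrite negbK => /eqP vy; have [uv tuv tuvv] := Ruv.
  (* If [v] is orthogonal to [y], then [u + v] is not, and it spans the same plane with [u]. *)
  apply: (step u (u + v)) => //; last by rewrite gram_formDl vy addr0.
  split; first by rewrite gram_formDr gram_formxx add0r.
    by rewrite tuvv.
  by rewrite addrA addvv_pchar2 // add0r tuvv.
have R_sym u v : R u v -> R v u.
  by case=> uv tuv tuvv; split; rewrite 1?gram_formC // addrC tuvv.
move=> xc txc txcc v v0; have Rxc : R x c by [].
(* A vector orthogonal neither to [x] nor to [v] links the two by two uses of [spread]. *)
have [y xy yv] : exists2 y, B x y != 0 & B y v != 0.
  have [y vy] := gram_form_nondeg v0; rewrite gram_formC in vy.
  have [xy|] := boolP (B x y != 0); first by exists y.
  rewrite negbK => /eqP xy; have [cv|] := boolP (B c v != 0); first by exists c.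
  rewrite negbK => /eqP cv.
  by exists (c + y); rewrite ?gram_formDr ?gram_formDl ?xy ?cv ?addr0 ?add0r.
have Rxy := spread _ _ _ Rxc xy.
have [_ <- _] := spread _ _ _ (R_sym _ _ Rxy) yv.
by have [_ -> _] := Rxy.
Qed.

Lemma Sp_bracket0 : (2 < #|F|)%N || (2 < a)%N ->
  forall x y, bracket tau x y = 0.
Proof.
move=> big; have one0 := oner_neq0 F.
have hyp x c : B x c != 0 -> bracket tau x c = 0.
  move=> xc; apply/eqP/negPn/negP=> b0.
  have [y [d [yd Eyd]]] := Sp_const_plane xc b0.
  have Ey k : k != 0 -> tau (k *: y) = bracket tau x c.
    by move=> k0; rewrite -(Eyd k 0) ?k0 // scale0r addr0.
  have Ed : tau d = bracket tau x c.
    by rewrite -(Eyd 0 1) ?one0 ?orbT // scale0r scale1r add0r.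
  have Edy k : tau (d + k *: y) = bracket tau x c.
    by rewrite -(Eyd k 1) ?one0 ?orbT // scale1r addrC.
  case/negP: b0; apply/eqP.
  have [F_le2|F_gt2] := leqP #|F| 2; last first.
    rewrite -(quad0 tauP); apply/esym.
    apply: (quad_const_plane tauP (x := y) (y := d)) => // k l kl.
    by rewrite add0r Eyd.
  have a2 : (2 < a)%N by move: big; rewrite ltnNge F_le2.
  have Econst v : v != 0 -> tau v = bracket tau x c.
    have Ey1 : tau y = bracket tau x c by rewrite -[y]scale1r Ey.
    rewrite -Ey1; apply: (Sp2_const F_le2 yd); first by rewrite Ey1 Ed.
    by have := Edy 1; rewrite scale1r addrC Ed.
  pose h0 := Ordinal (leq_trans (isT : (0 < 3)%N) a2).
  pose h1 := Ordinal (leq_trans (isT : (1 < 3)%N) a2).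
  pose h2 := Ordinal (leq_trans (isT : (2 < 3)%N) a2).
  have nz v h : v 0 h != 0 -> v != 0.
    by apply: contra => /eqP->; rewrite mxE.
  rewrite -(quad0 tauP); apply/esym.
  by apply: (quad_const_coset tauP (p := delta_mx 0 h0) (q := delta_mx 0 h1)
    (r := delta_mx 0 h2)); rewrite add0r; apply: Econst;
   first [apply: (@nz _ h2); by rewrite !mxE /= ?addr0 ?add0r
        | apply: (@nz _ h1); by rewrite !mxE /= ?addr0 ?add0r
        | apply: (@nz _ h0); by rewrite !mxE /= ?addr0 ?add0r].
move=> x y; have [xy|] := boolP (B x y != 0); first exact: hyp.
rewrite negbK => /eqP xy; have [->|x0] := eqVneq x 0.
  by rewrite bracketC (bracketx0 tauP).
(* Neither [y + z] nor [z] is orthogonal to [x], and [y] is their difference. *)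
have [z xz] := gram_form_nondeg x0; have xyz : B x (y + z) != 0.
  by rewrite gram_formDr xy add0r.
have := hyp _ _ xyz; rewrite (equad_bracketDr tauP) => /addv_eq0_F2->.
exact: hyp.
Qed.

End Symplectic.

(** * Squarings *)

Section Squarings.

Variables (m n : nat) (sigma : 'rV['F_2]_m.+1 -> 'rV['F_2]_n.+1).
Variables (A : {group {'GL_m.+1(2)}}) (B : {group {'GL_n.+1(2)}}).
Variable phi : {morphism A >-> {'GL_n.+1(2)}}.
Hypothesis sigmaP : datum sigma B phi.

Lemma squaring_bracketDr x y z :
  bracket sigma x (y + z) = bracket sigma x y + bracket sigma x z.
Proof. by have [[_ [_ bD] _] _] := sigmaP; apply: bD. Qed.

Lemma squaring0 : sigma 0 = 0.
Proof.
have := squaring_bracketDr 0 0 0.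
rewrite /bracket !addr0 -addrA addvv_F2 addr0 => s00.
by apply: (addrI (sigma 0)); rewrite -s00 addr0.
Qed.

(** By transitivity of [A], one nontrivial zero would make [sigma], hence its bracket, vanish
    everywhere. *)
Lemma squaring_eq0 x : sigma x = 0 -> x = 0.
Proof.
have [[_ _ [y [z yz0]]] [trA _ _ sA]] := sigmaP.
move=> sx0; apply/eqP/negPn/negP=> x0; case: yz0.
have s0 v : sigma v = 0.
  have [->|v0] := eqVneq v 0; first exact: squaring0.
  have [||g Ag ->] := atransP2 trA (x := x) (y := v); rewrite ?inE //.
  by rewrite sA // sx0 /rowact mul0mx.
by rewrite /sqbracket !s0 !addr0.
Qed.

Lemma squaring_surj w : exists x, sigma x = w.
Proof.
have [_ [_ trB imphi sA]] := sigmaP.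
have [->|w0] := eqVneq w 0; first by exists 0; exact: squaring0.
pose x : 'rV['F_2]_m.+1 := delta_mx 0 0.
have sx0 : sigma x != 0.
  apply/eqP=> /squaring_eq0/matrixP/(_ 0 0)/eqP.
  by rewrite !mxE !eqxx oner_eq0.
have [||h Bh ->] := atransP2 trB (x := sigma x) (y := w); rewrite ?inE //.
move: Bh; rewrite -imphi => /morphimP[g Ag _ ->].
by exists (rowact x g); rewrite sA.
Qed.

(** An element of [A] whose image moves [w1] to [w2] maps the first fibre injectively into the
    second. *)
Lemma card_squaring_fiber w1 w2 : w1 != 0 -> w2 != 0 ->
  (#|[set x | sigma x == w1]| <= #|[set x | sigma x == w2]|)%N.
Proof.
move=> w10 w20; have [_ [_ trB imphi sA]] := sigmaP.
have [||h Bh w2E] := atransP2 trB (x := w1) (y := w2); rewrite ?inE //.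
move: Bh; rewrite -imphi => /morphimP[g Ag _ hE].
rewrite -(card_imset _ (act_inj (rowaction _ _) g)).
apply/subset_leq_card/subsetP=> _ /imsetP[x + ->].
by rewrite !inE => /eqP sx; rewrite /= sA // sx w2E hE.
Qed.

Lemma squaring_card w : w != 0 ->
  ((2 ^ m.+1).-1 = (2 ^ n.+1).-1 * #|[set x | sigma x == w]|)%N.
Proof.
move=> w0.
have cardV k : #|[set~ 0 : 'rV['F_2]_k.+1]| = (2 ^ k.+1).-1.
  by rewrite cardsC1 card_mx card_Fp // mul1n.
have fE w' : w' \in [set~ 0] ->
    (\sum_(x in [set~ 0%R] | sigma x == w') 1 = #|[set x | sigma x == w]|)%N.
  rewrite !inE => w'0.
  rewrite (_ : #|_| = #|[set x | sigma x == w']|); last first.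
    by apply/eqP; rewrite eqn_leq !card_squaring_fiber.
  rewrite -sum1_card; apply: eq_bigl => x; rewrite !inE andb_idl //.
  by move=> /eqP sx; apply: contra w'0 => /eqP x0; rewrite -sx x0 squaring0.
rewrite -!cardV -[LHS]sum1_card.
rewrite (partition_big sigma (mem [set~ 0])) /=; last first.
  by move=> x; rewrite !inE; apply: contra => /eqP/squaring_eq0->.
by rewrite (eq_bigr _ fE) sum_nat_const.
Qed.

Lemma odd_squaring_fiber w : w != 0 -> odd #|[set x | sigma x == w]|.
Proof.
move=> /squaring_card E; have : odd (2 ^ m.+1).-1.
  by rewrite -subn1 oddB ?expn_gt0 // oddX.
by rewrite E oddM => /andP[].
Qed.

(* The fibre of a fixed vector of phi g has odd size, so the involution g has *)
(* a fixed point in it.                                                       *)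
Lemma squaring_fix g x : g \in A -> (g * g)%g = 1%g ->
    sigma (rowact x g) = sigma x ->
  exists2 u, rowact u g = u & sigma u = sigma x.
Proof.
move=> Ag gg sxg; have [sx0|sx0] := eqVneq (sigma x) 0.
  by exists 0; rewrite ?sx0 ?squaring0 // /rowact mul0mx.
have [_ [_ _ _ sA]] := sigmaP; pose E := [set u | sigma u == sigma x].
have g2 : 2.-group <[g]>%g.
  by rewrite /pgroup -orderE (pnat_dvd (n := 2)) // order_dvdn expgS expg1 gg.
have actE : [acts <[g]>%g, on E | rowaction _ _].
  rewrite cycle_subG; apply/astabsP=> /= u; rewrite !inE sA //.
  rewrite -{1}sxg sA //.
  exact: (inj_eq (act_inj (rowaction _ _) (phi g))).
have := pgroup_fix_mod g2 actE; rewrite !modn2 odd_squaring_fiber //.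
case: (set_0Vmem 'Fix_(E | rowaction _ _)(<[g]>)) => [->|[u]].
  by rewrite cards0.
rewrite inE => /andP[Eu /afixP/(_ g (cycle_id g)) ug] _; exists u => //.
by move: Eu; rewrite inE => /eqP.
Qed.

(** * Squarings viewed on a space over an extension field *)

Variables (F : finFieldType) (a : nat) (S : {set 'M[F]_a}).
Variable iota : {additive 'rV['F_2]_m.+1 -> 'rV[F]_a}.
Variable iotaV : 'rV[F]_a -> 'rV['F_2]_m.+1.
Hypotheses (iotaK : cancel iota iotaV) (iotaVK : cancel iotaV iota).

Lemma iotaVD x y : iotaV (x + y) = iotaV x + iotaV y.
Proof. by apply: (can_inj iotaK); rewrite raddfD /= !iotaVK. Qed.

(** Conjugation by [iota] turns [M] into an additive, hence [F_2]-linear, map, whose matrix is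
    [G]. *)
Lemma scalar_restriction_GL M : M \in unitmx ->
  exists g : {'GL_m.+1(2)}, forall x, iota (rowact x g) = iota x *m M.
Proof.
move=> uM; pose h x := iotaV (iota x *m M).
have hD x y : h (x + y) = h x + h y by rewrite /h raddfD mulmxDl iotaVD.
have h0 : h 0 = 0 by apply: (addrI (h 0)); rewrite -hD !addr0.
have hZ (c : 'F_2) x : h (c *: x) = c *: h x.
  by case: (F2_cases c) => ->; rewrite ?scale0r ?scale1r.
pose G := \matrix_i h (delta_mx 0 i).
have hG x : x *m G = h x.
  rewrite {2}(row_sum_delta x) mulmx_sum_row.
  elim/big_rec2: _ => [|i y z _ ->]; first by rewrite h0.
  by rewrite hD hZ rowK.
have uG : G \in unitmx.
  rewrite -row_free_unit; apply/inj_row_free=> v; rewrite hG => hv.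
  apply: (can_inj iotaK); have := congr1 iota hv.
  rewrite iotaVK !raddf0 => /(congr1 (mulmx^~ (invmx M))).
  by rewrite mulmxK // mul0mx.
by exists (FinRing.Unit (uG : G \is a GRing.unit)) => x; rewrite /rowact hG iotaVK.
Qed.

Hypotheses (Sunit : {subset S <= unitmx}).
Hypothesis SA : scalar_restriction iota S \subset A.

Lemma scalar_restriction_ex M : M \in S ->
  exists2 g, g \in A & forall x, iota (rowact x g) = iota x *m M.
Proof.
move=> SM; have [g gM] := scalar_restriction_GL (Sunit SM).
exists g => //; apply: (subsetP SA); rewrite inE; apply/existsP; exists M.
by rewrite SM; apply/forallP=> x; rewrite gM.
Qed.

Lemma squaring_equivariant_quadratic :
  equivariant_quadratic S (sigma \o iotaV).
Proof.
have rowactV g M : (forall x, iota (rowact x g) = iota x *m M) ->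
    forall v, iotaV (v *m M) = rowact (iotaV v) g.
  by move=> gM v; apply: (can_inj iotaK); rewrite iotaVK gM iotaVK.
have [_ [_ _ _ sA]] := sigmaP; split.
- move=> v /= /squaring_eq0 v0; rewrite -[v]iotaVK v0; exact: raddf0.
- by move=> w; have [x <-] := squaring_surj w; exists (iota x); rewrite /= iotaK.
- by move=> x y z; have := squaring_bracketDr (iotaV x) (iotaV y) (iotaV z);
    rewrite /bracket /= !iotaVD.
- move=> M /scalar_restriction_ex[g Ag /rowactV gM].
  by exists (GLval (phi g)) => v; rewrite /= gM sA.
- move=> M v SM MM; have [g Ag gM] := scalar_restriction_ex SM.
  (* Since [iota] is injective, the element of [A] inducing an involution squares to 1, as
     [squaring_fix] demands. *)
  have gg : (g * g)%g = 1%g.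
    apply: val_inj; apply/row_matrixP=> i; rewrite !rowE.
    rewrite -[LHS]/(rowact _ (g * g)%g) -[RHS]/(rowact _ 1%g) rowact1 rowactM.
    by apply: (can_inj iotaK); rewrite !gM -mulmxA MM mulmx1.
  rewrite /= (rowactV _ _ gM) => /(squaring_fix Ag gg)[u ug su].
  by exists (iota u); rewrite ?iotaK // -gM ug.
- have -> : (#|F| ^ a)%N = (2 ^ m.+1)%N.
    have := bij_eq_card (Bijective iotaK iotaVK).
    by rewrite !card_mx card_Fp // !mul1n.
  have w0 : (const_mx 1 : 'rV['F_2]_n.+1) != 0.
    by apply/eqP=> /matrixP/(_ 0 0)/eqP; rewrite !mxE oner_eq0.
  by rewrite (squaring_card w0) dvdn_mulr.
Qed.

Lemma squaring_bracket_neq0 :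
  ~ forall x y, bracket (sigma \o iotaV) x y = 0.
Proof.
have [[_ _ [x [y xy0]]] _] := sigmaP => b0; case: xy0.
by have := b0 (iota x) (iota y); rewrite /bracket /= iotaVD !iotaK.
Qed.

End Squarings.

(** * Root elements of G_2 *)

Section Chevalley.

Variable F : finFieldType.
Hypothesis F2 : 2 \in [pchar F].

(* In characteristic 2 the coefficients of polynomial identities can be taken *)
(* in bool, so that ring decides identities modulo 2; the aliases give it     *)
(* operations that it recognizes syntactically.                               *)
Definition addF (x y : F) : F := x + y.
Definition mulF (x y : F) : F := x * y.
Definition bool_in (b : bool) : F := if b then 1 else 0.

Lemma F_ring_theory :
  ring_theory (0 : F) 1 addF mulF addF id eq.
Proof.
split; rewrite /addF /mulF => *.
- exact: add0r.
- exact: addrC.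
- exact: addrA.
- exact: mul1r.
- exact: mulrC.
- exact: mulrA.
- exact: mulrDl.
- by [].
- exact: addrr_pchar2.
Qed.

Lemma F_ring_morph :
  ring_morph (0 : F) 1 addF mulF addF id eq
    false true xorb andb xorb id Bool.eqb bool_in.
Proof.
split=> //; rewrite /bool_in /addF /mulF.
- by case=> [] []; rewrite ?addr0 ?add0r // addrr_pchar2.
- by case=> [] []; rewrite ?addr0 ?add0r // addrr_pchar2.
- by case=> [] []; rewrite ?mulr0 ?mul0r ?mulr1.
- by case=> [] [].
Qed.

Add Ring F_ring : F_ring_theory (morphism F_ring_morph).

Let addFE x y : x + y = addF x y. Proof. by []. Qed.
Let mulFE x y : x * y = mulF x y. Proof. by []. Qed.

Ltac char2_ring := rewrite ?expr2 ?addFE ?mulFE; ring.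

(* Indices are read in Z/6 starting at i: the coordinate c_k is at i + k. *)
Definition hexrow (i : 'I_6) (c0 c1 c2 c3 c4 c5 : F) : 'rV[F]_6 :=
  \row_k nth 0 [:: c0; c1; c2; c3; c4; c5] (val (k - i)%R).

Lemma hexrowE i c0 c1 c2 c3 c4 c5 k :
  hexrow i c0 c1 c2 c3 c4 c5 0 (i + k) = nth 0 [:: c0; c1; c2; c3; c4; c5] k.
Proof. by rewrite mxE addrC addKr. Qed.

Lemma hexrow_rot i c0 c1 c2 c3 c4 c5 :
  hexrow i c0 c1 c2 c3 c4 c5 = hexrow (i + 1) c1 c2 c3 c4 c5 c0.
Proof.
apply/rowP=> k; rewrite -[k](subrKC i); move: (k - i) => {}k.
have kE : k = 1 + (k - 1) by rewrite subrKC.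
rewrite hexrowE [in RHS]kE addrA hexrowE {kE}.
by case: k => -[|[|[|[|[|[|]]]]]].
Qed.

Lemma hexrow_ex i u :
  exists c0 c1 c2 c3 c4 c5, u = hexrow i c0 c1 c2 c3 c4 c5.
Proof.
exists (u 0 (i + 0)), (u 0 (i + 1)), (u 0 (i + 2)), (u 0 (i + 3)).
exists (u 0 (i + 4)), (u 0 (i + 5)); apply/rowP=> k.
rewrite -[k](subrKC i); move: (k - i) => {}k; rewrite hexrowE.
by case: k => -[|[|[|[|[|[|]]]]]] //= ?; congr (u _ (i + _)); apply: val_inj.
Qed.

Lemma hexrowD i a0 a1 a2 a3 a4 a5 b0 b1 b2 b3 b4 b5 :
  hexrow i a0 a1 a2 a3 a4 a5 + hexrow i b0 b1 b2 b3 b4 b5 =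
  hexrow i (a0 + b0) (a1 + b1) (a2 + b2) (a3 + b3) (a4 + b4) (a5 + b5).
Proof.
apply/rowP=> k; rewrite !mxE; case: (k - i) => -[|[|[|[|[|[|]]]]]] //=.
Qed.

Lemma hexrowZ i c a0 a1 a2 a3 a4 a5 :
  c *: hexrow i a0 a1 a2 a3 a4 a5 =
  hexrow i (c * a0) (c * a1) (c * a2) (c * a3) (c * a4) (c * a5).
Proof.
apply/rowP=> k; rewrite !mxE; case: (k - i) => -[|[|[|[|[|[|]]]]]] //=.
Qed.

Lemma hexrow0 i : hexrow i 0 0 0 0 0 0 = 0.
Proof.
apply/rowP=> k; rewrite !mxE; case: (k - i) => -[|[|[|[|[|[|]]]]]] //=.
Qed.

Lemma hexrow_inj i a0 a1 a2 a3 a4 a5 b0 b1 b2 b3 b4 b5 :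
    hexrow i a0 a1 a2 a3 a4 a5 = hexrow i b0 b1 b2 b3 b4 b5 ->
  [/\ a0 = b0, a1 = b1 & a2 = b2] /\ [/\ a3 = b3, a4 = b4 & a5 = b5].
Proof.
move=> ab; have E k := congr1 (fun u : 'rV[F]_6 => u 0 (i + k)) ab.
have {}E k : [:: a0; a1; a2; a3; a4; a5]`_k = [:: b0; b1; b2; b3; b4; b5]`_k.
  case: (ltnP k 6) => [k6|k6]; last by rewrite !nth_default.
  by have := E (Ordinal k6); rewrite !hexrowE.
by do !split;
  [have := E 0|have := E 1|have := E 2|have := E 3|have := E 4|have := E 5].
Qed.

Lemma delta_hexrow (i : 'I_6) c : c *: delta_mx 0 i = hexrow i c 0 0 0 0 0.
Proof.
apply/rowP=> k; rewrite !mxE eqxx andTb -subr_eq0.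
by case: (k - i) => -[|[|[|[|[|[|]]]]]] //= ?; rewrite ?mulr0 ?mulr1.
Qed.

Lemma eq_hexrow (i : 'I_6) (M N : 'M[F]_6) :
    (forall c0 c1 c2 c3 c4 c5, hexrow i c0 c1 c2 c3 c4 c5 *m M =
                               hexrow i c0 c1 c2 c3 c4 c5 *m N) -> M = N.
Proof.
move=> MN; apply/row_matrixP=> k; rewrite !rowE.
by have [c0 [c1 [c2 [c3 [c4 [c5 ->]]]]]] := hexrow_ex i (delta_mx 0 k).
Qed.

Lemma mulmx_delta (u : 'rV[F]_6) (p q : 'I_6) :
  u *m delta_mx p q = u 0 p *: delta_mx 0 q.
Proof.
rewrite -(mul_delta_mx (0 : 'I_1)) mulmxA -colE [col p u]mx11_scalar.
by rewrite mul_scalar_mx mxE.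
Qed.

Let row_of_delta (i k : 'I_6) (x y z : F) (p q r : 'I_6) c0 c1 c2 c3 c4 c5 :
  (hexrow i c0 c1 c2 c3 c4 c5 + x *: delta_mx 0 (i + p) + y *: delta_mx 0 (i + q)
    + z *: delta_mx 0 (i + r)) 0 (i + k) =
  nth 0 [:: c0; c1; c2; c3; c4; c5] k
    + x * (k == p)%:R + y * (k == q)%:R + z * (k == r)%:R.
Proof.
have d j : (delta_mx 0 (i + j) : 'rV[F]_6) 0 (i + k) = (k == j)%:R.
  by rewrite mxE eqxx (inj_eq (addrI i)).
have D (u v : 'rV[F]_6) j : (u + v) 0 j = u 0 j + v 0 j by rewrite mxE.
have Z l (u : 'rV[F]_6) j : (l *: u) 0 j = l * u 0 j by rewrite mxE.
by rewrite !(D, Z) !d hexrowE.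
Qed.

Lemma hexrow_short i t c0 c1 c2 c3 c4 c5 :
  hexrow i c0 c1 c2 c3 c4 c5 *m G2_short_root i t =
  hexrow i (c0 + t * t * c3) (c1 + t * c2) c2 c3 c4 (c5 + t * c4).
Proof.
have -> : G2_short_root i t =
    1%:M + t *: (delta_mx (i + 2) (i + 1) + delta_mx (i + 4) (i + 5))
         + t ^+ 2 *: delta_mx (i + 3) (i + 0) by rewrite addr0.
rewrite !mulmxDr mulmx1 -!scalemxAr mulmxDr !mulmx_delta.
rewrite !hexrowE scalerDr !scalerA (addrA (hexrow _ _ _ _ _ _ _)); apply/rowP=> k.
have [h ->] : exists h, k = i + h by exists (k - i); rewrite subrKC.
rewrite hexrowE.
rewrite (row_of_delta i h _ _ _ 1 5 0).
by case: h => -[|[|[|[|[|[|]]]]]] //= ?; rewrite ?mulr0 ?mulr1 ?addr0 ?expr2.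
Qed.

Lemma hexrow_long i t c0 c1 c2 c3 c4 c5 :
  hexrow i c0 c1 c2 c3 c4 c5 *m G2_long_root i t =
  hexrow i (c0 + t * c4) (c1 + t * c3) c2 c3 c4 c5.
Proof.
have -> : G2_long_root i t =
    1%:M + t *: (delta_mx (i + 3) (i + 1) + delta_mx (i + 4) (i + 0)).
  by rewrite addr0.
rewrite !mulmxDr mulmx1 -!scalemxAr mulmxDr !mulmx_delta.
rewrite !hexrowE scalerDr !scalerA (addrA (hexrow _ _ _ _ _ _ _)); apply/rowP=> k.
have [h ->] : exists h, k = i + h by exists (k - i); rewrite subrKC.
have E := row_of_delta i h (t * c3) (t * c4) 0 1 0 0 c0 c1 c2 c3 c4 c5.
rewrite scale0r (addr0 (_ + _ *: _)) in E; rewrite hexrowE; apply: (etrans E) => {E}.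
by case: h => -[|[|[|[|[|[|]]]]]] //= ?; rewrite ?mulr0 ?mulr1 ?addr0.
Qed.

Lemma hexrow_rot2 i c0 c1 c2 c3 c4 c5 :
  hexrow i c0 c1 c2 c3 c4 c5 = hexrow (i + 2) c2 c3 c4 c5 c0 c1.
Proof. by rewrite 2!hexrow_rot -!addrA. Qed.

Lemma hexrow_rot3 i c0 c1 c2 c3 c4 c5 :
  hexrow i c0 c1 c2 c3 c4 c5 = hexrow (i + 3) c3 c4 c5 c0 c1 c2.
Proof. by rewrite 3!hexrow_rot -!addrA. Qed.

Lemma hexrow_rot4 i c0 c1 c2 c3 c4 c5 :
  hexrow i c0 c1 c2 c3 c4 c5 = hexrow (i + 4) c4 c5 c0 c1 c2 c3.
Proof. by rewrite 4!hexrow_rot -!addrA. Qed.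

Lemma hexrow_rot5 i c0 c1 c2 c3 c4 c5 :
  hexrow i c0 c1 c2 c3 c4 c5 = hexrow (i + 5) c5 c0 c1 c2 c3 c4.
Proof. by rewrite 5!hexrow_rot -!addrA. Qed.

(** Rotation of the indices reduces all cases to [hexrow_short]. The equations form one tuple so
    that a single rewrite picks the one that matches. *)
Lemma hexrow_shortE i t c0 c1 c2 c3 c4 c5 :
  let v := hexrow i c0 c1 c2 c3 c4 c5 in
  (v *m G2_short_root (i + 1) t =
      hexrow i (c0 + t * c5) (c1 + t * t * c4) (c2 + t * c3) c3 c4 c5)
  * (v *m G2_short_root (i + 2) t =
      hexrow i c0 (c1 + t * c0) (c2 + t * t * c5) (c3 + t * c4) c4 c5)
  * (v *m G2_short_root (i + 3) t =
      hexrow i c0 c1 (c2 + t * c1) (c3 + t * t * c0) (c4 + t * c5) c5)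
  * (v *m G2_short_root (i + 4) t =
      hexrow i c0 c1 c2 (c3 + t * c2) (c4 + t * t * c1) (c5 + t * c0))
  * (v *m G2_short_root (i + 5) t =
      hexrow i (c0 + t * c1) c1 c2 c3 (c4 + t * c3) (c5 + t * t * c2)).
Proof.
move=> v; do ?split; rewrite /v.
- by rewrite hexrow_rot hexrow_short -hexrow_rot.
- by rewrite hexrow_rot2 hexrow_short -hexrow_rot2.
- by rewrite hexrow_rot3 hexrow_short -hexrow_rot3.
- by rewrite hexrow_rot4 hexrow_short -hexrow_rot4.
- by rewrite hexrow_rot5 hexrow_short -hexrow_rot5.
Qed.

Lemma hexrow_longE i t c0 c1 c2 c3 c4 c5 :
  let v := hexrow i c0 c1 c2 c3 c4 c5 in
  (v *m G2_long_root (i + 1) t =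
      hexrow i c0 (c1 + t * c5) (c2 + t * c4) c3 c4 c5)
  * (v *m G2_long_root (i + 2) t =
      hexrow i c0 c1 (c2 + t * c0) (c3 + t * c5) c4 c5)
  * (v *m G2_long_root (i + 3) t =
      hexrow i c0 c1 c2 (c3 + t * c1) (c4 + t * c0) c5)
  * (v *m G2_long_root (i + 4) t =
      hexrow i c0 c1 c2 c3 (c4 + t * c2) (c5 + t * c1))
  * (v *m G2_long_root (i + 5) t =
      hexrow i (c0 + t * c2) c1 c2 c3 c4 (c5 + t * c3)).
Proof.
move=> v; do ?split; rewrite /v.
- by rewrite hexrow_rot hexrow_long -hexrow_rot.
- by rewrite hexrow_rot2 hexrow_long -hexrow_rot2.
- by rewrite hexrow_rot3 hexrow_long -hexrow_rot3.
- by rewrite hexrow_rot4 hexrow_long -hexrow_rot4.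
- by rewrite hexrow_rot5 hexrow_long -hexrow_rot5.
Qed.

(** * Relations between root elements *)

Lemma G2_long_invol i t : G2_long_root i t *m G2_long_root i t = 1%:M :> 'M[F]_6.
Proof.
apply: (@eq_hexrow i) => *; rewrite mulmx1 mulmxA !hexrow_long.
congr (hexrow i _ _ _ _ _ _); char2_ring.
Qed.

Lemma G2_short_invol i t : G2_short_root i t *m G2_short_root i t = 1%:M :> 'M[F]_6.
Proof.
apply: (@eq_hexrow i) => *; rewrite mulmx1 mulmxA !hexrow_short.
congr (hexrow i _ _ _ _ _ _); char2_ring.
Qed.

Lemma G2_shortD i t s :
  G2_short_root i t *m G2_short_root i s = G2_short_root i (t + s) :> 'M[F]_6.
Proof.
apply: (@eq_hexrow i) => *; rewrite mulmxA !hexrow_short.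
congr (hexrow i _ _ _ _ _ _); char2_ring.
Qed.

(** The commutator formula for two long roots at 120 degrees; the factors are involutions, so the
    left side is their commutator. *)
Lemma G2_long_comm i t s :
  G2_long_root i t *m G2_long_root (i + 2) s
    *m G2_long_root i t *m G2_long_root (i + 2) s
  = G2_long_root (i + 1) (t * s) :> 'M[F]_6.
Proof.
apply: (@eq_hexrow i) => *; rewrite !mulmxA !(hexrow_long, hexrow_longE).
congr (hexrow i _ _ _ _ _ _); char2_ring.
Qed.

(** The commutator formula for a short root [r] and a long root [l] at 150 degrees; the factors on
    the right belong to [2r + l], [r + l], [3r + l] and [3r + 2l]. *)
Lemma G2_short_long_comm i t s :
  G2_short_root i t *m G2_long_root (i + 2) s
    *m G2_short_root i t *m G2_long_root (i + 2) s
  = G2_short_root (i + 1) (t * t * s) *m G2_short_root (i + 2) (t * s)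
    *m G2_long_root i (t * t * t * s) *m G2_long_root (i + 1) (t * t * t * s * s)
  :> 'M[F]_6.
Proof.
apply: (@eq_hexrow i) => *; rewrite !mulmxA.
rewrite !(hexrow_long, hexrow_longE, hexrow_short, hexrow_shortE).
congr (hexrow i _ _ _ _ _ _); char2_ring.
Qed.

Lemma G2_order8 (i : 'I_6) (g := G2_short_root (i + 2) (1 : F)
    *m G2_short_root (i + 3) 1 *m G2_long_root i 1) :
  g *m g *m (g *m g) = G2_long_root (i + 1) 1.
Proof.
have g2 c0 c1 c2 c3 c4 c5 : hexrow i c0 c1 c2 c3 c4 c5 *m (g *m g) =
    hexrow i (c0 + c5) (c0 + c1 + c4 + c5) (c2 + c3 + c5) (c3 + c4) c4 c5.
  rewrite /g !mulmxA.
  rewrite !(hexrow_long, hexrow_longE, hexrow_short, hexrow_shortE) !mul1r.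
  congr (hexrow i _ _ _ _ _ _); char2_ring.
apply: (@eq_hexrow i) => *; rewrite mulmxA !g2 hexrow_longE mul1r.
congr (hexrow i _ _ _ _ _ _); char2_ring.
Qed.

(** * Root elements in the derived subgroup *)

Local Notation G2' := (G2der_mx F).

Lemma mem_G2_root i t (M : 'M[F]_6) :
    (M == G2_short_root i t) || (M == G2_long_root i t) ->
  exists2 g, g \in G2 F & GLval g = M.
Proof.
move=> Mroot; have MM : M *m M = 1%:M.
  by case/orP: Mroot => /eqP->; rewrite ?G2_short_invol ?G2_long_invol.
have uM : M \is a GRing.unit by case/mulmx1_unit: MM.
exists (FinRing.Unit uM) => //; apply: mem_gen; rewrite inE.
by apply/existsP; exists i; apply/existsP; exists t.
Qed.

Let GLvalM (g h : {'GL_6[F]}) : GLval (g * h)%g = GLval g *m GLval h.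
Proof. by []. Qed.

Let G2der_val (g : {'GL_6[F]}) : g \in (G2 F)^`(1)%g -> GLval g \in G2'.
Proof. by move=> Gg; apply/imsetP; exists g. Qed.

Lemma G2der_mul M N : M \in G2' -> N \in G2' -> M *m N \in G2'.
Proof.
case/imsetP=> g Gg -> /imsetP[h Gh ->].
by rewrite -(GLvalM g h) G2der_val // groupM.
Qed.

Lemma G2der_inv M N : M \in G2' -> M *m N = 1%:M -> N \in G2'.
Proof.
case/imsetP=> g Gg -> gN.
have -> : N = GLval g^-1%g.
  by rewrite -[RHS]mulmx1 -gN mulmxA -(GLvalM g^-1 g) mulVg GL_1E mul1mx.
by rewrite G2der_val // groupV.
Qed.

Lemma G2der_mulr M N : M *m N \in G2' -> N \in G2' -> N *m N = 1%:M -> M \in G2'.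
Proof. by move=> GMN GN NN; rewrite -[M]mulmx1 -NN mulmxA G2der_mul. Qed.

Lemma G2der_comm (g h : {'GL_6[F]}) : g \in G2 F -> h \in G2 F ->
    GLval g *m GLval g = 1%:M -> GLval h *m GLval h = 1%:M ->
  GLval g *m GLval h *m GLval g *m GLval h \in G2'.
Proof.
move=> Gg Gh gg hh; have invol (k : {'GL_6[F]}) :
    GLval k *m GLval k = 1%:M -> k^-1%g = k.
  move=> kk; have {}kk : (k * k = 1)%g by apply: val_inj; exact: kk.
  by rewrite -[RHS]mul1g -(mulVg k) -mulgA kk mulg1.
rewrite -(GLvalM g h) -(GLvalM _ g) -(GLvalM _ h).
have -> : (g * h * g * h)%g = [~ g, h].
  by rewrite commgEl conjgE (invol g gg) (invol h hh) !mulgA.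
by rewrite G2der_val // mem_commg.
Qed.

(** Each long root is the sum of its two neighbours among the long roots, so [G2_long_comm] gives a
    commutator. *)
Lemma G2der_long i t : G2_long_root i t \in G2'.
Proof.
have [|g Gg gE] := @mem_G2_root (i - 1) t (G2_long_root (i - 1) t).
  by rewrite eqxx orbT.
have [|h Gh hE] := @mem_G2_root (i - 1 + 2) 1 (G2_long_root (i - 1 + 2) 1).
  by rewrite eqxx orbT.
have -> : G2_long_root i t = G2_long_root (i - 1 + 1) (t * 1).
  by rewrite subrK mulr1.
rewrite -G2_long_comm -gE -hE; apply: G2der_comm => //.
  by rewrite gE G2_long_invol.
by rewrite hE G2_long_invol.
Qed.

(** The long root factors in [G2_short_long_comm] lie in the derived subgroup and can be
    cancelled. *)
Lemma G2der_short_short i t s :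
  G2_short_root i (t * t * s) *m G2_short_root (i + 1) (t * s) \in G2'.
Proof.
have [|g Gg gE] := @mem_G2_root (i - 1) t (G2_short_root (i - 1) t).
  by rewrite eqxx.
have [|h Gh hE] := @mem_G2_root (i - 1 + 2) s (G2_long_root (i - 1 + 2) s).
  by rewrite eqxx orbT.
have := G2der_comm Gg Gh; rewrite gE hE G2_short_invol G2_long_invol.
rewrite G2_short_long_comm => /(_ erefl erefl) G4.
have -> : i + 1 = i - 1 + 2 by rewrite -addrA; congr (i + _); apply: val_inj.
rewrite -[X in G2_short_root X (t * t * s)](subrK 1 i).
apply: G2der_mulr (G2der_long (i - 1) (t * t * t * s)) (G2_long_invol _ _).
by apply: G2der_mulr G4 (G2der_long _ _) (G2_long_invol _ _).
Qed.

(** The parameters [k] and 1 in [G2der_short_short] give two products with the same second factor;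
    their quotient is the short root element with parameter [(k + 1) * r = t]. *)
Lemma G2der_short i t : (2 < #|F|)%N -> G2_short_root i t \in G2'.
Proof.
move=> q2; have [k k0 k1] := card_gt2_neq01 q2.
have k1' : k + 1 != 0 by rewrite -[1](oppr_pchar2 F2) subr_eq0.
pose r := t / (k + 1).
have rk : k * (r / k) = r by rewrite mulrCA mulfV // mulr1.
have := G2der_short_short i k (r / k); have := G2der_short_short i 1 r.
rewrite !mul1r -mulrA rk.
set N := G2_short_root (i + 1) r; have NN : N *m N = 1%:M by exact: G2_short_invol.
move=> G1 Gk.
have N1 : N *m G2_short_root i r \in G2'.
  apply: G2der_inv G1 _.
  by rewrite mulmxA -(mulmxA _ N N) NN mulmx1 G2_short_invol.
have := G2der_mul Gk N1; rewrite mulmxA -(mulmxA _ N N) NN mulmx1 G2_shortD.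
by rewrite -{2}[r]mul1r -mulrDl mulrC mulfVK.
Qed.

End Chevalley.

(** * The groups G_2(q)' *)

Lemma pchar2_sqrt (F : finFieldType) (x : F) : 2 \in [pchar F] ->
  exists y, y * y = x.
Proof.
move=> F2; have sq_inj : injective (fun y : F => y * y).
  move=> y z /eqP; rewrite -!expr2 -subr_eq0 subr_sqr mulf_eq0 subr_eq0.
  by rewrite -[z in y + z](oppr_pchar2 F2) subr_eq0 orbb => /eqP.
by have [f _ fK] := injF_bij sq_inj; exists (f x); rewrite fK.
Qed.

Section G2.

Variables (F : finFieldType) (n : nat) (tau : 'rV[F]_6 -> 'rV['F_2]_n).
Hypotheses (F2 : 2 \in [pchar F]) (tauP : equivariant_quadratic (G2der_mx F) tau).

(** Index distances 4 and 5 are 2 and 1 with the arguments exchanged. *)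
Lemma G2_bracket_eq0 :
    (forall i l m, bracket tau (hexrow i l 0 0 0 0 0) (hexrow i m 0 0 0 0 0) = 0) ->
    (forall i l m, bracket tau (hexrow i l 0 0 0 0 0) (hexrow i 0 m 0 0 0 0) = 0) ->
    (forall i l m, bracket tau (hexrow i l 0 0 0 0 0) (hexrow i 0 0 m 0 0 0) = 0) ->
    (forall i l m, bracket tau (hexrow i l 0 0 0 0 0) (hexrow i 0 0 0 m 0 0) = 0) ->
  forall x y, bracket tau x y = 0.
Proof.
move=> b0 b1 b2 b3; apply: (bracket_eq0_delta tauP) => i j l m.
have [h ->] : exists h, j = i + h by exists (j - i); rewrite subrKC.
rewrite !delta_hexrow; case: h => -[|[|[|[|[|[|]]]]]] //= h.
- have -> : i + Ordinal h = i by rewrite -[RHS]addr0; congr (i + _); apply: val_inj.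
  exact: b0.
- have -> : Ordinal h = 1 by apply: val_inj.
  by rewrite -hexrow_rot.
- have -> : Ordinal h = 2 by apply: val_inj.
  by rewrite -hexrow_rot2.
- have -> : Ordinal h = 3 by apply: val_inj.
  by rewrite -hexrow_rot3.
- have -> : Ordinal h = 4 by apply: val_inj.
  by rewrite (hexrow_rot4 i) bracketC.
- have -> : Ordinal h = 5 by apply: val_inj.
  by rewrite (hexrow_rot5 i) bracketC.
Qed.

(** * Fields with more than two elements *)

Section LargeField.

Hypothesis q2 : (2 < #|F|)%N.

(** The short root element with [t * t = l / m] adds the vector at [i] to the one at [i + 3]. Its
    fixed vectors, those with zero coordinates 2, 3 and 4, are fixed for every parameter [s]. *)
Lemma G2_short_stab i l m v s : l != 0 -> m != 0 ->
    tau v = bracket tau (hexrow i l 0 0 0 0 0) (hexrow i 0 0 0 m 0 0) ->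
  tau (v *m G2_short_root i s) = tau v.
Proof.
move=> l0 m0; set z := hexrow i l _ _ _ _ _; set x := hexrow i _ _ _ m _ _.
move=> tv; have [t tt] := pchar2_sqrt (l / m) F2.
have t0 : t != 0.
  by apply: contraNneq l0 => t0; rewrite -[l](mulfVK m0) -tt t0 !mul0r.
apply: (bracket_stab_invol tauP (M := G2_short_root i t) (x := x)).
- exact: G2der_short.
- exact: G2der_short.
- exact: G2_short_invol.
- move=> u; have [c0 [c1 [c2 [c3 [c4 [c5 ->]]]]]] := hexrow_ex i u.
  rewrite !hexrow_short => /hexrow_inj[[E0 E1 _] [_ _ E5]].
  have c3_0 : c3 = 0.
    apply/eqP; have /eqP := E0; rewrite -[X in _ == X]addr0 (inj_eq (addrI c0)).
    by rewrite !mulf_eq0 (negPf t0).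
  have c2_0 : c2 = 0.
    apply/eqP; have /eqP := E1; rewrite -[X in _ == X]addr0 (inj_eq (addrI c1)).
    by rewrite mulf_eq0 (negPf t0).
  have c4_0 : c4 = 0.
    apply/eqP; have /eqP := E5; rewrite -[X in _ == X]addr0 (inj_eq (addrI c5)).
    by rewrite mulf_eq0 (negPf t0).
  by rewrite c2_0 c3_0 c4_0 !mulr0 !addr0.
- have -> : x *m G2_short_root i t = z + x.
    by rewrite hexrow_short hexrowD tt !(mulr0, addr0, add0r) mulfVK.
  by rewrite (equad_bracketDr tauP) (bracketxx tauP) // addr0 bracketC.
Qed.

Lemma G2_opposite i l m :
  bracket tau (hexrow i l 0 0 0 0 0) (hexrow i 0 0 0 m 0 0) = 0.
Proof.
have [->|l0] := eqVneq l 0; first by rewrite hexrow0 bracketC (bracketx0 tauP).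
have [->|m0] := eqVneq m 0; first by rewrite hexrow0 (bracketx0 tauP).
apply/eqP/negPn/negP; set z := hexrow i l _ _ _ _ _; set x := hexrow i _ _ _ m _ _.
set w := bracket tau z x => w0.
have st0 v s : tau v = w -> tau (v *m G2_short_root i s) = w.
  by move=> tv; rewrite (G2_short_stab s l0 m0 tv).
have st3 v s : tau v = w -> tau (v *m G2_short_root (i + 3) s) = w.
  rewrite /w bracketC /x /z (hexrow_rot3 i l) (hexrow_rot3 i 0) => tv.
  by rewrite (G2_short_stab s m0 l0 tv).
have stl j v s : z *m G2_long_root j s = z -> x *m G2_long_root j s = x ->
    tau v = w -> tau (v *m G2_long_root j s) = w.
  move=> zj xj tv; rewrite (bracket_stab tauP (x := z) (y := x)) //.
  exact: G2der_long.
(* The long roots at [i + 1] and [i + 4] are orthogonal to the weights of [z] and [x]. *)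
have st1 v s : tau v = w -> tau (v *m G2_long_root (i + 1) s) = w.
  by apply: stl; rewrite hexrow_longE !mulr0 !addr0.
have st4 v s : tau v = w -> tau (v *m G2_long_root (i + 4) s) = w.
  by apply: stl; rewrite hexrow_longE !mulr0 !addr0.
have [u u1 tu] : exists2 u, u *m G2_short_root i 1 = u & tau u = w.
  have [v tv] := equad_surj tauP w.
  rewrite -tv; apply: (equad_fix tauP); rewrite ?st0 ?G2_short_invol ?tv //.
  exact: G2der_short.
have [c0 [c1 [c5 uE]]] : exists c0 c1 c5, u = hexrow i c0 c1 0 0 0 c5.
  have [c0 [c1 [c2 [c3 [c4 [c5 uE]]]]]] := hexrow_ex i u.
  exists c0, c1, c5; move: u1; rewrite uE hexrow_short !mul1r.
  move=> /hexrow_inj[[/eqP E0 /eqP E1 _] [_ _ /eqP E5]].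
  rewrite -[X in _ == X]addr0 (inj_eq (addrI _)) in E0.
  rewrite -[X in _ == X]addr0 (inj_eq (addrI _)) in E1.
  rewrite -[X in _ == X]addr0 (inj_eq (addrI _)) in E5.
  by rewrite (eqP E0) (eqP E1) (eqP E5).
(* The opposite long root groups act on coordinates 1 and 5 as [SL_2(F)], so [quad_const_plane]
   clears both. *)
have tc0 : tau (hexrow i c0 0 0 0 0 0) = w.
  have [c15|] := boolP ((c1 != 0) || (c5 != 0)); last first.
    by rewrite negb_or !negbK => /andP[/eqP c1_0 /eqP c5_0]; rewrite -tu uE c1_0 c5_0.
  apply: (quad_const_plane tauP (x := hexrow i 0 1 0 0 0 0)
    (y := hexrow i 0 0 0 0 0 1)) => // k l' kl.
  rewrite !hexrowZ !hexrowD !(mulr0, addr0, add0r, mulr1).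
  apply: (SL2_orbit (E := fun k l' => tau (hexrow i c0 k 0 0 0 l') = w)
    (k0 := c1) (l0 := c5)) => //.
  - move=> k1 k2 s /(st1 _ s).
    by rewrite hexrow_longE !(mulr0, addr0).
  - move=> k1 k2 s /(st4 _ s).
    by rewrite hexrow_longE !(mulr0, addr0).
  - by rewrite -uE.
have c00 : c0 != 0.
  by apply: contra w0 => /eqP c00; rewrite -tc0 c00 hexrow0 (quad0 tauP).
case/negP: w0; rewrite -(quad0 tauP) eq_sym; apply/eqP.
(* The opposite short root groups act on this plane as [SL_2(F)]; their parameters enter squared,
   and every field element is a square. The outcome is [tau 0 = w]. *)
apply: (quad_const_plane tauP (x := hexrow i 1 0 0 0 0 0)
    (y := hexrow i 0 0 0 1 0 0)) => // k l' kl.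
rewrite add0r !hexrowZ !hexrowD !(mulr0, addr0, add0r, mulr1).
apply: (SL2_orbit (E := fun k l' => tau (hexrow i k 0 0 l' 0 0) = w)
    (k0 := c0) (l0 := 0)) => //.
- move=> k1 k2 s; have [r <-] := pchar2_sqrt s F2; move=> /(st0 _ r).
  by rewrite hexrow_short !(mulr0, addr0).
- move=> k1 k2 s; have [r <-] := pchar2_sqrt s F2; move=> /(st3 _ r).
  by rewrite hexrow_shortE !(mulr0, addr0).
- by rewrite c00.
Qed.

(** Short root elements at [i + 1], [i] and [i + 5] fix the first vector and successively lower the
    index distance from 3 to 2, 1 and 0. *)
Lemma G2_large_bracket0 x y : bracket tau x y = 0.
Proof.
have tr M u v u' : M \in G2der_mx F -> u *m M = u -> v *m M = v + u' ->
    bracket tau u v = 0 -> bracket tau u u' = 0.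
  move=> GM uM vM uv; have := bracket_transport tauP GM uv.
  by rewrite uM vM (equad_bracketDr tauP) uv add0r.
have b2 i l m : bracket tau (hexrow i l 0 0 0 0 0) (hexrow i 0 0 m 0 0 0) = 0.
  apply: tr (G2der_short F2 (i + 1) 1 q2) _ _ (G2_opposite i l m);
    by rewrite hexrow_shortE ?hexrowD !(mulr0, mul1r, addr0, add0r).
have b1 i l m : bracket tau (hexrow i l 0 0 0 0 0) (hexrow i 0 m 0 0 0 0) = 0.
  apply: tr (G2der_short F2 i 1 q2) _ _ (b2 i l m);
    by rewrite hexrow_short ?hexrowD !(mulr0, mul1r, addr0, add0r).
apply: G2_bracket_eq0 => // i l m; last exact: G2_opposite.
apply: tr (G2der_short F2 (i + 5) 1 q2) _ _ (b1 i l m);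
  by rewrite (hexrow_shortE i _ _ _ _ _ _ _).2 ?hexrowD
             !(mulr0, mul1r, addr0, add0r).
Qed.

End LargeField.

(** * The field of two elements *)

Section SmallField.

Hypothesis q2 : (#|F| <= 2)%N.

Let F01 (c : F) : c = 0 \/ c = 1.
Proof.
by have [->|/(card_F2_unit q2)->] := eqVneq c 0; [left | right].
Qed.

(* The element of order 8 acts on a space of at most 8 vectors with orbits of *)
(* length at most 4, so its fourth power acts trivially.                      *)
Lemma G2_long_trivial i v : (n <= 3)%N ->
  tau (v *m G2_long_root i 1) = tau v.
Proof.
move=> n3; pose j := i - 1.
pose g : 'M[F]_6 := G2_short_root (j + 2) 1 *m G2_short_root (j + 3) 1
                      *m G2_long_root j 1.
have Gg : g \in G2der_mx F.
  apply: G2der_mul (G2der_long F2 _ _).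
  have := G2der_short_short F2 (j + 2) 1 1; rewrite !mulr1.
  suff -> : j + 2 + 1 = j + 3 by [].
  by rewrite -addrA; congr (j + _); apply: val_inj.
have g4 : g *m g *m (g *m g) = G2_long_root i 1.
  by rewrite G2_order8 // subrK.
have [L tL] := equad_lin tauP Gg; pose f (w : 'rV['F_2]_n) := w *m L.
have tf k u : iter k f (tau u) = tau (iter k (mulmxr g) u).
  by elim: k => //= k ->; rewrite /f -tL.
have f8 w : iter 8 f w = w.
  have [u <-] := equad_surj tauP w; rewrite tf /=; congr (tau _).
  rewrite -!(mulmxA _ g g) -!(mulmxA _ (g *m g) (g *m g)) g4.
  by rewrite -mulmxA G2_long_invol // mulmx1.
have f_inj : injective f by apply: (can_inj (g := iter 7 f)) => w; apply: f8.
have fc w a b : (a <= b)%N -> iter a f w = iter b f w -> iter (b - a) f w = w.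
  move=> /subnKC{1}<-; move: (b - a)%N => d.
  by elim: a => [|a IH]; [move=> /= <- | rewrite addSn => /f_inj/IH].
have f4 w : iter 4 f w = w.
  have [->|w0] := eqVneq w 0; first by rewrite /f /= !mul0mx.
  pose h (k : 'I_8) := iter k f w.
  have h0 k : h k != 0.
    apply: contraNneq w0 => hk; rewrite -(f8 w) -(subnK (ltnW (ltn_ord k))) iterD.
    rewrite -/(h k) hk; elim: (8 - k)%N => //= e /eqP->.
    by rewrite /f mul0mx.
  (* Eight nonzero iterates lie among at most seven nonzero vectors. *)
  have /injectivePn[k [k' kk' hkk']] : ~~ injectiveb h.
    apply/negP=> /injectiveP/card_imset h8.
    have : [set h k | k in 'I_8] \subset [set~ 0].
      by apply/subsetP=> _ /imsetP[k _ ->]; rewrite !inE.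
    move=> /subset_leq_card; rewrite h8 card_ord cardsC1 card_mx card_Fp // mul1n.
    rewrite leqNgt prednK ?expn_gt0 // => /negP[].
    by rewrite -[8%N]/(2 ^ 3)%N leq_exp2l.
  have [d d0 [d8 fd]] : exists2 d, (0 < d)%N & (d < 8)%N /\ iter d f w = w.
    case: (ltngtP k k') => [lt|lt|/val_inj E]; last by rewrite E eqxx in kk'.
      exists (k' - k)%N; first by rewrite subn_gt0.
      by split; [exact: leq_ltn_trans (leq_subr _ _) _ | apply: fc (ltnW lt) hkk'].
    exists (k - k')%N; first by rewrite subn_gt0.
    split; first exact: leq_ltn_trans (leq_subr _ _) _.
    exact: fc (ltnW lt) (esym hkk').
  have fdm e : iter (e * d) f w = w.
    by elim: e => // e IH; rewrite mulSn iterD IH.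
  have f8m e : iter (8 * e) f w = w.
    by elim: e => // e IH; rewrite mulnS iterD IH f8.
  have f48 e : iter (4 + 8 * e) f w = iter 4 f w by rewrite iterD f8m.
  (* For [0 < d < 8] the gcd of [d] and 8 divides 4, so 4 is a multiple of [d] modulo 8. *)
  have [e [r er]] : exists e r, (e * d = 4 + 8 * r)%N.
    move: d0 d8; rewrite {fd fdm}; case: d => [|[|[|[|[|[|[|[|d]]]]]]]] // _ _.
    - by exists 4%N, 0%N.
    - by exists 2%N, 0%N.
    - by exists 4%N, 1%N.
    - by exists 1%N, 0%N.
    - by exists 4%N, 2%N.
    - by exists 2%N, 1%N.
    - by exists 4%N, 3%N.
  by rewrite -(f48 r) -er.
rewrite -g4 -[RHS]f4 tf /=; congr (tau _).
by rewrite !mulmxA.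
Qed.

(** If [n <= 3], the long root elements preserve [tau]. They link all nonzero vectors of the 3-space
    on the indices 0, 2 and 4, against [quad_const_coset]. *)
Lemma G2_codomain_gt3 : (3 < n)%N.
Proof.
rewrite ltnNge; apply/negP=> n3.
have tr v i := G2_long_trivial i v n3.
pose T a b c := tau (hexrow 0 a 0 b 0 c 0); pose w := T 1 0 0.
have r0 a b c : T (a + c) b c = T a b c.
  by rewrite /T -[RHS](tr _ 0) hexrow_long !(mul1r, addr0).
have r2 a b c : T a (b + a) c = T a b c.
  by rewrite /T -[RHS](tr _ (0 + 2)) hexrow_longE !(mul1r, addr0).
have r3 a b c : T a b (c + a) = T a b c.
  by rewrite /T -[RHS](tr _ (0 + 3)) hexrow_longE !(mul1r, addr0).
have r5 a b c : T (a + b) b c = T a b c.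
  by rewrite /T -[RHS](tr _ (0 + 5)) (hexrow_longE 0 _ _ _ _ _ _ _).2 !(mul1r, addr0).
have t110 : T 1 1 0 = w by have := r2 1 0 0; rewrite add0r.
have t101 : T 1 0 1 = w by have := r3 1 0 0; rewrite add0r.
have t111 : T 1 1 1 = w by have := r3 1 1 0; rewrite add0r => ->.
have t010 : T 0 1 0 = w by have := r5 0 1 0; rewrite add0r => <-.
have t001 : T 0 0 1 = w by have := r0 0 0 1; rewrite add0r => <-.
have t011 : T 0 1 1 = w by have := r5 0 1 1; rewrite add0r => <-.
have w0 : w = 0.
  rewrite -(quad0 tauP); apply/esym.
  by apply: (quad_const_coset tauP (p := hexrow 0 1 0 0 0 0 0)
    (q := hexrow 0 0 0 1 0 0 0) (r := hexrow 0 0 0 0 0 1 0));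
    rewrite add0r ?hexrowD ?(addr0, add0r).
have /(equad_eq0 tauP) := w0; rewrite -(hexrow0 F 0) => /hexrow_inj[[/eqP]].
by rewrite oner_eq0.
Qed.

(** Among [n = 4, 5, 6] only 6 has [2^n - 1] dividing 63; a surjection between sets of size 64 is
    injective. *)
Lemma G2_small_inj : injective tau.
Proof.
have F2E : #|F| = 2%N by apply/eqP; rewrite eqn_leq q2 finNzRing_gt1.
have n6 : n = 6%N.
  have := equad_card tauP; rewrite F2E; have := G2_codomain_gt3.
  have [n7|] := leqP n 6; last first.
    move=> n7 _ dvd; have := dvdn_leq (isT : (0 < (2 ^ 6).-1)%N) dvd.
    have : (2 ^ 6 < 2 ^ n)%N by rewrite ltn_exp2l.
    by case: (2 ^ n)%N => // e; rewrite /= ltnS => lt /(leq_trans lt); rewrite ltnn.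
  by case: n n7 => [|[|[|[|[|[|[|]]]]]]].
have card_im : #|[set tau v | v : 'rV[F]_6]| = #|{: 'rV[F]_6}|.
  rewrite (_ : [set _ | _ in _] = setT); last first.
    apply/setP=> w; rewrite inE; apply/imsetP.
    by have [v <-] := equad_surj tauP w; exists v.
  by rewrite cardsT !card_mx F2E card_Fp // n6.
by move=> u v; apply: (imset_injP _ : {in predT &, injective tau}); rewrite ?card_im.
Qed.

(** The product of the two long root elements has order 3, and its fixed space is the plane of [x]
    and [z]. By injectivity [tau x + tau z] is the value of a vector of that plane, and only [x + z]
    is possible. *)
Lemma G2_small_opposite i l m :
  bracket tau (hexrow i l 0 0 0 0 0) (hexrow i 0 0 0 m 0 0) = 0.
Proof.
case: (F01 l) => ->; first by rewrite hexrow0 bracketC (bracketx0 tauP).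
case: (F01 m) => ->; first by rewrite hexrow0 (bracketx0 tauP).
set x := hexrow i 1 _ _ _ _ _; set z := hexrow i _ _ _ 1 _ _.
have [u tu] := equad_surj tauP (tau x + tau z).
have GM : G2_long_root (i + 1) 1 *m G2_long_root (i + 4) 1 \in G2der_mx F.
  exact: G2der_mul (G2der_long _ _ _) (G2der_long _ _ _).
have uM : u *m (G2_long_root (i + 1) 1 *m G2_long_root (i + 4) 1) = u.
  apply: G2_small_inj; have [L tL] := equad_lin tauP GM.
  rewrite tL tu mulmxDl -!tL !mulmxA !hexrow_longE.
  by rewrite !(mulr0, addr0).
have [c0 [c3 uE]] : exists c0 c3, u = hexrow i c0 0 0 c3 0 0.
  have [c0 [c1 [c2 [c3 [c4 [c5 uE]]]]]] := hexrow_ex i u.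
  exists c0, c3; move: uM; rewrite uE mulmxA !hexrow_longE !mul1r.
  have eq0 a b : a + b = a -> b = 0 :> F.
    by move/eqP; rewrite -[X in _ == X]addr0 (inj_eq (addrI _)) => /eqP.
  move=> /hexrow_inj[[_ /eq0 c5_0 /eq0 c4_0] [_ /eq0 c2_0 /eq0 c1_0]].
  by move: c2_0 c1_0; rewrite c4_0 c5_0 !addr0 => -> ->.
have x_neq : x <> 0.
  by rewrite -(hexrow0 F i) => /hexrow_inj[[/eqP]]; rewrite oner_eq0.
have z_neq : z <> 0.
  by rewrite -(hexrow0 F i) => /hexrow_inj[_ [/eqP]]; rewrite oner_eq0.
move: tu; rewrite uE; case: (F01 c0) => ->; case: (F01 c3) => ->.
- rewrite hexrow0 (quad0 tauP) => /esym/addv_eq0_F2/G2_small_inj.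
  by move=> /hexrow_inj[[/eqP]]; rewrite oner_eq0.
- move=> /eqP; rewrite -/z -{1}[tau z]add0r (inj_eq (addIr _)) eq_sym.
  by move=> /eqP/(equad_eq0 tauP).
- move=> /eqP; rewrite -/x -{1}[tau x]addr0 (inj_eq (addrI _)) eq_sym.
  by move=> /eqP/(equad_eq0 tauP).
- move=> txz; rewrite /bracket hexrowD !(addr0, add0r) txz.
  by rewrite -addrA addvv_F2.
Qed.

Lemma G2_small_bracket0 x y : bracket tau x y = 0.
Proof.
have b1 i l m : bracket tau (hexrow i l 0 0 0 0 0) (hexrow i 0 m 0 0 0 0) = 0.
  have := bracket_transport tauP (G2der_long F2 i 1) (G2_small_opposite i l m).
  rewrite !hexrow_long !(mulr0, mul1r, addr0, add0r).
  have -> : hexrow i 0 m 0 m 0 0 = hexrow i 0 0 0 m 0 0 + hexrow i 0 m 0 0 0 0.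
    by rewrite hexrowD !(addr0, add0r).
  by rewrite (equad_bracketDr tauP) G2_small_opposite add0r.
apply: G2_bracket_eq0 => //; last exact: G2_small_opposite.
  move=> i l m; case: (F01 l) => ->.
    by rewrite hexrow0 bracketC (bracketx0 tauP).
  case: (F01 m) => ->; first by rewrite hexrow0 (bracketx0 tauP).
  exact: (bracketxx tauP).
move=> i l m.
(* [G2der_short] needs a larger field; here two products from [G2der_short_short] share the factor
   at [i], which cancels. *)
have GM : G2_short_root (i + 5) 1 *m G2_short_root (i + 1) 1 \in G2der_mx F.
  have := G2der_short_short F2 i 1 1; rewrite !mulr1.
  have := G2der_short_short F2 (i + 5) 1 1; rewrite !mulr1.
  have -> : i + 5 + 1 = i.
    by rewrite -addrA -[RHS]addr0; congr (i + _); apply: val_inj.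
  move=> G5 G0; have := G2der_mul G5 G0.
  rewrite mulmxA -(mulmxA _ (G2_short_root i 1) (G2_short_root i 1)).
  by rewrite G2_short_invol // mulmx1.
have b24 : bracket tau (hexrow i l 0 0 0 0 0) (hexrow i 0 0 m 0 m 0) = 0.
  have := bracket_transport tauP GM (G2_small_opposite i l m).
  rewrite !mulmxA !(hexrow_shortE i _ _ _ _ _ _ _).2 !(mulr0, mul1r, addr0, add0r).
  rewrite !hexrow_shortE !(mulr0, mul1r, addr0, add0r).
  have -> : hexrow i 0 m m m m 0 = hexrow i 0 0 0 m 0 0 +
      (hexrow i 0 m 0 0 0 0 + hexrow i 0 0 m 0 m 0).
    by rewrite !hexrowD !(addr0, add0r).
  by rewrite !(equad_bracketDr tauP) G2_small_opposite b1 !add0r.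
(* This long root element fixes the first vector and adds coordinate 2 to coordinate 4, which
   becomes [m + m = 0]. *)
have := bracket_transport tauP (G2der_long F2 (i + 4) 1) b24.
rewrite !hexrow_longE !(mulr0, mul1r, addr0, add0r).
by rewrite addrr_pchar2.
Qed.

End SmallField.

Lemma G2_bracket0 x y : bracket tau x y = 0.
Proof.
have [q2|q2] := leqP #|F| 2; first exact: G2_small_bracket0.
exact: G2_large_bracket0.
Qed.

End G2.

(** * The three families of groups *)

Lemma Sp_unitmx (F : finFieldType) a (J : 'M[F]_a) : symplectic_gram J ->
  {subset Spmx J <= unitmx}.
Proof.
move=> [uJ _] M; rewrite inE => /eqP MJM.
by move: uJ; rewrite -MJM !unitmx_mul => /andP[/andP[]].
Qed.

Lemma G2der_unitmx (F : finFieldType) : {subset G2der_mx F <= unitmx}.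
Proof. by move=> M /imsetP[g _ ->]; exact: (valP g). Qed.

Lemma SL_unitmx (F : finFieldType) a : {subset SLmx F a <= unitmx}.
Proof. by move=> M; rewrite inE unitmxE => /eqP->; apply: unitr1. Qed.

(** For [b = 1] the dimension [a] is all of [k]; a larger [b] gives a field with more than two
    elements. This rules out the solvable group [SL_2(2)]. *)
Lemma ltn_expn_or b a k : (0 < b)%N -> (2 < k)%N -> k = (a * b)%N ->
  (2 < 2 ^ b)%N || (2 < a)%N.
Proof.
case: b => [|[|b]] // _ k2 kab; last by rewrite (@ltn_exp2l 2 1).
by rewrite orbC -(muln1 a) -kab k2.
Qed.

Local Close Scope ring_scope.
Local Close Scope group_scope.

Theorem proposition3p1 (m n : nat)
    (sigma : 'rV['F_2]_m.+1 -> 'rV['F_2]_n.+1)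
    (A : {group {'GL_m.+1(2)}}) (B : {group {'GL_n.+1(2)}})
    (phi : {morphism A >-> {'GL_n.+1(2)}}) :
  datum sigma B phi ->
  ~ [\/ 3 <= m.+1 /\ (exists a b : nat,
          [/\ 0 < b, 1 < a, m.+1 = a * b & normal_SL A a b]),
        4 <= m.+1 /\ (exists a b : nat,
          [/\ 0 < a, 0 < b, 2 %| a, m.+1 = a * b & normal_Sp A a b])
      | 6 <= m.+1 /\ (exists b : nat, m.+1 = 6 * b /\ normal_G2der A b)].
Proof.
move=> sigmaP; case.
- case=> m3 [a [b [b0 a1 mab [F [iota [cardF [iotaV iotaK iotaVK] nSA]]]]]].
  have F2 := card_finPcharP cardF isT.
  have tauP := squaring_equivariant_quadratic sigmaP iotaK iotaVK
    (@SL_unitmx F a) (normal_sub nSA).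
  apply: (squaring_bracket_neq0 sigmaP iotaK iotaVK).
  apply: (SL_bracket0 F2 tauP) => //.
  by rewrite cardF; apply: ltn_expn_or mab.
- case=> m4 [a [b [_ b0 _ mab [F [iota [J [cardF [iotaV iotaK iotaVK] JP nSA]]]]]]].
  have F2 := card_finPcharP cardF isT.
  have tauP := squaring_equivariant_quadratic sigmaP iotaK iotaVK
    (Sp_unitmx JP) (normal_sub nSA).
  apply: (squaring_bracket_neq0 sigmaP iotaK iotaVK).
  apply: (Sp_bracket0 F2 JP tauP).
  by rewrite cardF; apply: ltn_expn_or mab; rewrite // ltnW.
- case=> m6 [b [mb [F [iota [cardF [iotaV iotaK iotaVK] nSA]]]]].
  have b0 : 0 < b by case: b mb {cardF} => //; rewrite muln0.
  have F2 := card_finPcharP cardF isT.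
  have tauP := squaring_equivariant_quadratic sigmaP iotaK iotaVK
    (@G2der_unitmx F) (normal_sub nSA).
  apply: (squaring_bracket_neq0 sigmaP iotaK iotaVK).
  exact: (G2_bracket0 F2 tauP).
Qed.
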